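(* Let $B\in\mathbb{R}^{N\times N}$ be symmetric positive definite, $B_0\in\mathbb{R}^{N\times N}$ symmetric, $s\in\mathbb{R}^N$ with $s\neq 0$, and $y=Bs$. Let $\alpha\in\mathbb{R}\setminus\{0\}$. For each of the following choices of $W$, provided that $W$ or $-W$ is positive definite, the one-step posterior mean for the Gaussian regression model with prior mean $B_0$ and prior covariance $W\circledast W$, given the observation $y$ along $s$, is the named update of $B_0$: 1. $W=\alpha I$: the Powell symmetric Broyden update, $D(s)$. 2. The implicit choice $W=\alpha(B-B_0)$: the Symmetric Rank-1 update, $D(y-B_0s)$. For the specific rank-1 observation $(s,y)$ there is a whole (affine) linear subspace of symmetric matrices $W$ with $Ws=\alpha(y-B_0s)$, but $W=\alpha(B-B_0)$ is the only globally consistent such choice, i.e. the only one with $Wv=\alpha(Bv-B_0v)$ for every $v\in\mathbb{R}^N$. 3. $W=\alpha B_0$: the Greenstadt update, $D(B_0s)$. 4. The implicit choice $W=\alpha B$: the DFP update, $D(y)$. This choice is unique in the analogous manner: for the specific observation $(s,y)$ there is a whole (affine) linear subspace of symmetric matrices $W$ with $Ws=\alpha y$, but $W=\alpha B$ is the only globally consistent such choice, i.e. the only one with $Wv=\alpha Bv$ for every $v\in\mathbb{R}^N$. 5. The implicit choice $W=\alpha(B+rB_0)$ with $r=\sqrt{\tfrac{s^{\top}Bs}{s^{\top}B_0s}}$ (where $s^{\top}B_0s>0$): the BFGS update, $D\Bigl(y+\sqrt{\tfrac{y^{\top}s}{s^{\top}B_0s}}\,B_0s\Bigr)$. This choice,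 too, is unique in the analogous manner: for the specific observation $(s,y)$ there is a whole (affine) linear subspace of symmetric matrices $W$ with $Ws=\alpha(y+rB_0s)$, but $W=\alpha(B+rB_0)$ is the only globally consistent such choice, i.e. (with the scalar $r$ held fixed) the only one with $Wv=\alpha(Bv+rB_0v)$ for every $v\in\mathbb{R}^N$.
   Context: For $c\in\mathbb{R}^N$ with $c^{\top}s\ne0$, $D(c)$ denotes the Dennis-class update of $B_0$ with vector $c$: $$ D(c)=B_{0} + \frac{(y-B_{0}s)c^{\top} + c(y-B_{0}s)^{\top}}{c^{\top} s} - \frac{c\, s^{\top}(y-B_0s)\, c^{\top}}{(c^{\top} s)^2}. $$ For $A\in\mathbb{R}^{N\times N}$, $\mathrm{vec}(A)\in\mathbb{R}^{N^2}$ is the vector of its elements, $\mathrm{vec}(A)_{(ij)}=A_{ij}$. For symmetric $A$, $A\circledast A$ is the $N^2\times N^2$ matrix with elements $(A\circledast A)_{(ij),(k\ell)}=\tfrac12(A_{ik}A_{j\ell}+A_{jk}A_{i\ell})$; note that it is unchanged under $A\to -A$. The Gaussian regression model with prior mean $B_0$ and covariance $W\circledast W$ is: a random symmetric matrix $X$ with $\mathrm{vec}(X)\sim\mathcal{N}(\mathrm{vec}(B_0),W\circledast W)$ (a possibly degenerate Gaussian law supported on symmetric matrices). Its one-step posterior mean is the mean of the conditional distribution of $X$ given the noise-free observation $Xs=y$ (equivalently, the limit $\sigma\to0$ of the posterior means under Gaussian likelihood with mean $Xs$ and covariance $\sigma^2I$). In items 2, 4 and 5 the matrix $W$ depends on the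 unknown $B$, which is why these choices are called implicit. *)

(* Defs.v *)
From HB Require Import structures.
From mathcomp Require Import all_boot all_order all_algebra.
From mathcomp Require Import all_classical all_reals all_analysis.
Set Implicit Arguments.
Unset Strict Implicit.
Unset Printing Implicit Defensive.
Import Order.TTheory GRing.Theory Num.Theory.
Import numFieldNormedType.Exports.
Local Open Scope classical_set_scope.
Local Open Scope ring_scope.

Section LinearAlgebra.
Context {R : realType} {N : nat}.
Implicit Types (A B W : 'M[R]_N) (c s y z : 'cV[R]_N).

Definition dot c s : R := (c^T *m s) 0 0.

Definition posdef A : Prop :=
  A^T = A /\ (forall v : 'cV[R]_N, v != 0 -> 0 < dot v (A *m v)).

Definition definite W : Prop := posdef W \/ posdef (- W).

Definition dennis_update B0 s y c : 'M[R]_N :=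
  let d := y - B0 *m s in
  B0 + (dot c s)^-1 *: (d *m c^T + c *m d^T)
     - (dot c s ^+ 2)^-1 *: (c *m s^T *m d *m c^T).

(* The pair (i, j) encoded by an index of [mxvec A]: inverse of [mxvec_index]. *)
Definition vec_pair (p : 'I_(N * N)) : 'I_N * 'I_N :=
  enum_val (cast_ord (esym (mxvec_cast N N)) p).

Definition symkron A : 'M[R]_(N * N) :=
  \matrix_(p, q)
    let: (i, j) := vec_pair p in
    let: (k, l) := vec_pair q in
    2^-1 * (A i k * A j l + A j k * A i l).

Lemma symkronE A i j k l :
  symkron A (mxvec_index i j) (mxvec_index k l)
  = 2^-1 * (A i k * A j l + A j k * A i l).
Proof. by rewrite mxE /vec_pair /mxvec_index !cast_ordK !enum_rankK. Qed.

(* The symmetric W with W s = z form an affine subspace W0 + V of the matrix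
   space.  It is not a single point as soon as N >= 2; for N = 1 the equation
   W s = z with s != 0 determines W. *)
Definition affine_family s z : Prop :=
  exists (W0 : 'M[R]_N) (V : {vspace 'M[R]_N}),
    ((1 < N)%N -> V <> 0%VS) /\
    (forall W, (W^T = W /\ W *m s = z) <-> W - W0 \in V).

(* Wc is one of the symmetric W with W s = h s, and it is the only one of them
   with W v = h v for every v. *)
Definition only_consistent s (h : 'cV[R]_N -> 'cV[R]_N) (Wc : 'M[R]_N) : Prop :=
  forall W, [/\ W^T = W, W *m s = h s & forall v, W *m v = h v] <-> W = Wc.

End LinearAlgebra.

Section Gaussian.
Context {R : realType}.

(* The normal law of mean m and variance v >= 0, which is the point mass at m
   if v = 0 ([normal_prob m 0] is not that point mass). *)
Definition normal_law (m v : R) (A : set R) : \bar R :=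
  if v == 0 then \d_m A else normal_prob m (Num.sqrt v) A.

(* V ~ N(m, S), possibly degenerate: every linear combination of the entries
   of V is normal, with the mean and variance prescribed by m and S. *)
Definition gaussian_vector d (T : measurableType d) (P : probability T R)
    n (V : T -> 'rV[R]_n) (m : 'rV[R]_n) (S : 'M[R]_n) : Prop :=
  (forall i, measurable_fun setT (fun t => V t 0 i)) /\
  (forall a : 'cV[R]_n,
    let v := (a^T *m S *m a) 0 0 in
    0 <= v /\
    forall A : set R, measurable A ->
      P ((fun t => (V t *m a) 0 0) @^-1` A) = normal_law ((m *m a) 0 0) v A).

Definition gaussian_model d (T : measurableType d) (P : probability T R)
    N (X : T -> 'M[R]_N) (B0 W : 'M[R]_N) : Prop :=
  (forall t, (X t)^T = X t) /\
  gaussian_vector P (fun t => mxvec (X t)) (mxvec B0) (symkron W).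

(* Density at y of the law N(A s, sigma^2 I). *)
Definition likelihood N (s y : 'cV[R]_N) (sigma : R) (A : 'M[R]_N) : R :=
  \prod_(k < N) normal_pdf ((A *m s) k 0) sigma (y k 0).

(* Bayes' rule: the posterior has density proportional to the likelihood with
   respect to the prior, the law of X under P. *)
Definition noisy_posterior_mean d (T : measurableType d) (P : probability T R)
    N (X : T -> 'M[R]_N) (s y : 'cV[R]_N) (sigma : R) : 'M[R]_N :=
  \matrix_(i, j)
    ((\int[P]_t (X t i j * likelihood s y sigma (X t))) /
     (\int[P]_t likelihood s y sigma (X t))).

(* M is the mean of X given X s = y, for prior N(mxvec B0, symkron W).  As the
   event X s = y is in general null, the conditioning is the noise-free limit
   sigma -> 0+. *)
Definition posterior_mean_is N (B0 W : 'M[R]_N) (s y : 'cV[R]_N)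
    (M : 'M[R]_N) : Prop :=
  forall (d : measure_display) (T : measurableType d) (P : probability T R)
    (X : T -> 'M[R]_N),
  gaussian_model P X B0 W ->
  forall i j, noisy_posterior_mean P X s y sigma i j @[sigma --> 0^'+] --> M i j.

End Gaussian.

(* Main.v *)
(** By Bayes' rule the posterior density is proportional to the Gaussian weight
    [prod_k exp (- (y_k - (X s)_k)^2 / (2 sigma^2))]. Stein's identity
    [E (L_b f) = E (D_{S b} f)], where [L_b] is the centred linear form [b] of a
    Gaussian vector of covariance [S], turns the posterior mean [M] at noise
    level [sigma] into [M - B0 = (W q c^T + c (W q)^T) / 2], with [c = W s] and
    [q = (y - M s) / sigma^2]. Any such [M] is the Dennis update, with vector
    [c], of [B0] for the data [M s]; moreover [q] stays bounded as [sigma -> 0],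
    so [M s -> y] and [M] converges to the update for the data [y].

    As only the laws of linear forms are given, Stein's identity is first
    proved for trigonometric polynomials, by differentiating
    [t |-> E cos (th + L_a + t L_b)], which the characteristic function of a
    normal law makes explicit. It passes to the Gaussian weight by dominated
    convergence, since [cos (x / n) ^ n^2 -> exp (- x^2 / 2)]. *)
Require Import Defs.
From mathcomp Require Import all_boot all_order all_algebra.
From mathcomp Require Import all_classical all_reals all_analysis.
From mathcomp Require Import measurable_realfun ring lra.
Set Implicit Arguments.
Unset Strict Implicit.
Unset Printing Implicit Defensive.
Import Order.TTheory GRing.Theory Num.Theory.
Import numFieldNormedType.Exports.
Local Open Scope classical_set_scope.
Local Open Scope ring_scope.

(** * Integrals against the normal law *)

Section NormalLaw.
Context {R : realType}.
Notation mu := (@lebesgue_measure R).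

(** Change of variables holds for the Radon-Nikodym derivative of the normal law. That derivative
    agrees almost everywhere with [normal_pdf], since both have the same integral over every
    measurable set. *)
Lemma ge0_integral_normal_prob (m s : R) (f : R -> \bar R) :
  measurable_fun setT f -> (forall x, 0 <= f x)%E ->
  (\int[normal_prob m s]_x f x = \int[mu]_x (f x * (normal_pdf m s x)%:E))%E.
Proof.
move=> mf f0.
have dom := normal_prob_dominates m s.
have fi := Radon_Nikodym_SigmaFinite.f_integrable dom.
rewrite -(Radon_Nikodym_SigmaFinite.change_of_variables dom f0)//.
have mpdf : measurable_fun setT (fun x => (normal_pdf m s x)%:E).
  by apply/measurable_EFinP; exact: measurable_normal_pdf.
apply: ae_eq_integral => //.
- by apply: emeasurable_funM => //; exact: measurable_int fi.
- exact: emeasurable_funM.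
- apply: ae_eqe_mul2l; apply: integral_ae_eq => // E _ mE.
  by rewrite -Radon_Nikodym_SigmaFinite.f_integral.
Qed.

Lemma integrable_normal_prob (m s : R) (f : R -> R) :
  measurable_fun setT f ->
  mu.-integrable setT (fun x => (f x * normal_pdf m s x)%:E) ->
  (normal_prob m s).-integrable setT (EFin \o f).
Proof.
move=> mf /integrableP[_ h]; apply/integrableP; split; first exact/measurable_EFinP.
rewrite ge0_integral_normal_prob//; last first.
  by apply: measurableT_comp => //; exact/measurable_EFinP.
apply: le_lt_trans h; rewrite le_eqVlt; apply/orP; left; apply/eqP.
apply: eq_integral => x _ /=.
by rewrite normrM (ger0_norm (normal_pdf_ge0 _ _ _)).
Qed.

(** The density is nonnegative, so multiplication by it commutes with taking positive and negative
    parts; each part is then covered by the nonnegative case. *)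
Lemma Rintegral_normal_prob (m s : R) (f : R -> R) :
  (normal_prob m s).-integrable setT (EFin \o f) ->
  mu.-integrable setT (fun x => (f x * normal_pdf m s x)%:E) /\
  \int[normal_prob m s]_x f x = \int[mu]_x (f x * normal_pdf m s x).
Proof.
move=> fi; have mf : measurable_fun setT f by apply/measurable_EFinP; exact: measurable_int fi.
have mfp : measurable_fun setT (fun x => (f x * normal_pdf m s x)%:E).
  by apply/measurable_EFinP/measurable_funM => //; exact: measurable_normal_pdf.
have ifp : mu.-integrable setT (fun x => (f x * normal_pdf m s x)%:E).
  apply/integrableP; split => //.
  move/integrableP : fi => [_]; rewrite ge0_integral_normal_prob//; last first.
    by apply: measurableT_comp => //; exact/measurable_EFinP.
  apply: le_lt_trans; rewrite le_eqVlt; apply/orP; left; apply/eqP.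
  apply: eq_integral => x _ /=.
  by rewrite normrM (ger0_norm (normal_pdf_ge0 _ _ _)).
split=> //; congr fine.
rewrite [LHS]integralE [RHS]integralE; congr (_ - _)%E.
- rewrite ge0_integral_normal_prob//; last first.
    by apply: measurable_funepos; exact/measurable_EFinP.
  apply: eq_integral => x _.
  rewrite !funeposE/= -!EFin_max -EFinM; congr EFin.
  by rewrite maxr_pMl ?normal_pdf_ge0// mul0r.
- rewrite ge0_integral_normal_prob//; last first.
    by apply: measurable_funeneg; exact/measurable_EFinP.
  apply: eq_integral => x _.
  rewrite !funenegE/= -!EFin_max -EFinM; congr EFin.
  by rewrite maxr_pMl ?normal_pdf_ge0// mul0r mulNr.
Qed.

Lemma integrable_centered_normal_pdf (m s : R) : s != 0 ->
  mu.-integrable setT (fun x => ((x - m) * normal_pdf m s x)%:E).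
Proof.
(* (x - m)^2 / (2 s^2) = 2 w^2 with |w| <= expR (w^2), so that the integrand
   is at most a multiple of the density of N(m, 2 s^2) *)
move=> s0.
pose s2 := Num.sqrt 2 * s.
have s20 : s2 != 0 by rewrite mulf_neq0// sqrtr_eq0 -ltNge.
have := integrable_normal_pdf m s2.
pose k := 2 * `|s| * normal_peak s / normal_peak s2.
move=> /(@integrableZl _ _ _ _ _ measurableT k).
apply: le_integrable => //.
  apply/measurable_EFinP/measurable_funM; last exact: measurable_normal_pdf.
  exact: measurable_funB.
move=> x _ /=; rewrite lee_fin.
have k0 : 0 <= k.
  by apply: divr_ge0; [apply: mulr_ge0 => //|]; exact: normal_peak_ge0.
rewrite normrM (ger0_norm (normal_pdf_ge0 _ _ _)).
rewrite [leRHS]ger0_norm; last by apply: mulr_ge0 => //; exact: normal_pdf_ge0.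
have p20 : normal_peak s2 != 0 by rewrite gt_eqF// normal_peak_gt0.
rewrite !normal_pdfE//.
have -> : k * (normal_peak s2 * normal_fun m s2 x) =
    normal_peak s * (2 * `|s| * normal_fun m s2 x) by rewrite /k; field.
rewrite mulrCA ler_wpM2l ?normal_peak_ge0// /normal_fun.
(* This is the [w] of the bound above. The exponent is [- 2 u^2]: one [u^2] absorbs the linear
   factor, and the other is the exponent of the density with deviation [s2]. *)
pose u := `|x - m| / (2 * `|s|).
have ns0 : `|s| != 0 by rewrite normr_eq0.
have E4 : (x - m) ^+ 2 = (2 * `|s| * u) ^+ 2.
  by rewrite /u mulrCA divff ?mulr1 ?real_normK ?num_real// mulf_neq0.
have -> : - (x - m) ^+ 2 / (s ^+ 2 *+ 2) = - u ^+ 2 - u ^+ 2.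
  by rewrite E4 -(real_normK (num_real s)); field.
have -> : - (x - m) ^+ 2 / (s2 ^+ 2 *+ 2) = - u ^+ 2.
  have -> : s2 ^+ 2 = 2 * s ^+ 2 by rewrite exprMn sqr_sqrtr.
  by rewrite E4 -(real_normK (num_real s)); field.
rewrite expRD mulrA ler_wpM2r ?expR_ge0// expRN.
rewrite ler_pdivrMr ?expR_gt0//.
have {1}-> : `|x - m| = 2 * `|s| * u by rewrite /u mulrCA divff ?mulr1// mulf_neq0.
rewrite ler_wpM2l ?mulr_ge0//.
by apply: le_trans (expR_ge1Dx _); nra.
Qed.

Lemma integrable_centered_normal (m s : R) : s != 0 ->
  (normal_prob m s).-integrable setT (fun x => (x - m)%:E).
Proof.
move=> s0; apply: integrable_normal_prob; last exact: integrable_centered_normal_pdf.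
exact: measurable_funB.
Qed.

Lemma is_derive_normal_pdf (m s x : R) : s != 0 ->
  is_derive x 1 (normal_pdf m s) (- (x - m) / s ^+ 2 * normal_pdf m s x).
Proof.
move=> s0; rewrite normal_pdfE//.
pose g := (- (s ^+ 2 *+ 2)^-1) \*: ((id - cst m) ^+ 2 : R -> R).
have -> : (fun x => normal_peak s * normal_fun m s x) = normal_peak s \*: (expR \o g).
  apply/funext => z; rewrite /normal_fun /g /=; congr (_ * expR _).
  by rewrite /= !fctE /= scaleNr mulNr mulrC.
apply: is_derive_eq => /=.
have -> : g x = - (x - m) ^+ 2 / (s ^+ 2 *+ 2).
  by rewrite /g !fctE/= scaleNr mulNr mulrC.
rewrite /GRing.scale/= !fctE /normal_fun; field.
by [].
Qed.
End NormalLaw.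

Lemma bounded_integrable {R : realType} d (T : measurableType d)
    (P : probability T R) (f : T -> R) (M : R) :
  measurable_fun setT f -> (forall x, `|f x| <= M) ->
  P.-integrable setT (EFin \o f).
Proof.
move=> mf fM; apply: measurable_bounded_integrable => //.
  by rewrite (le_lt_trans (probability_le1 _ _))// ltry.
exists M; split; first exact: num_real.
by move=> x x1 z _ /=; rewrite (le_trans (fM _))// ltW.
Qed.

(** * Stein's identity for one normal variable *)

Section WholeLine.
Context {R : realType}.
Notation mu := (@lebesgue_measure R).

(** The fundamental theorem of calculus on growing symmetric intervals, followed by dominated
    convergence with majorant [|f|]. *)
Lemma Rintegral_derive_eq0 (f F : R -> R) :
  (forall x : R, is_derive x 1 F (f x)) -> continuous f ->
  mu.-integrable setT (EFin \o f) ->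
  F n%:R @[n --> \oo] --> 0 -> F (- n%:R) @[n --> \oo] --> 0 ->
  \int[mu]_x f x = 0.
Proof.
move=> dF cf fi Fp Fn.
have mf : measurable_fun setT f by exact: continuous_measurable_fun.
have dFx x : derivable F x 1 by have [] := dF x.
have cF : continuous F by move=> x; apply/differentiable_continuous/derivable1_diffP.
(* The shift to [n.+1] keeps every interval nondegenerate, as the fundamental theorem requires. *)
pose D n : set R := `[- n.+1%:R, n.+1%:R]%classic.
have mD n : measurable (D n) by exact: measurable_itv.
pose g n := f \_ (D n).
have gE n : (\int[mu]_x (g n x)%:E = (F n.+1%:R - F (- n.+1%:R))%:E)%E.
  transitivity (\int[mu]_(x in D n) (f x)%:E)%E.
    rewrite [RHS]integral_mkcond; apply: eq_integral => x _.
    by rewrite restrict_EFin.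
  rewrite (@continuous_FTC2 _ f F) ?EFinB//.
  - by rewrite ltrNl (lt_trans _ (ltr0Sn _ _))// oppr_lt0.
  - exact: continuous_subspaceT.
  - split; [by move=> x _|..].
    + by apply: cvg_at_right_filter; exact: cF.
    + by apply: cvg_at_left_filter; exact: cF.
  - by move=> x _; rewrite derive1E; have [_ ->] := dF x.
have lim1 : (\int[mu]_x (g n x)%:E @[n --> \oo] --> (\int[mu]_x (f x)%:E))%E.
  apply: (@dominated_cvg _ _ _ mu setT measurableT (fun n x => (g n x)%:E)
    (fun x => (f x)%:E) (fun x => `|f x|%:E)) => //.
  - move=> n; apply/measurable_EFinP; have [+ _] := measurable_restrictT f (mD n).
    by apply; exact: measurable_funTS.
  - move=> x _; apply: cvg_EFin; first exact: nearW.
    apply: cvg_near_cst; near=> n; rewrite /comp /= /g patchE mem_set//.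
    rewrite /D/= in_itv/= -ler_norml (@le_trans _ _ n%:R)//; last by rewrite ler_nat.
    by near: n; exact: nbhs_infty_ger.
  - exact: integrable_norm fi.
  - move=> n x _ /=; rewrite lee_fin /g patchE.
    by case: ifPn => // _; rewrite normr0.
have lim2 : (\int[mu]_x (g n x)%:E @[n --> \oo] --> 0%:E)%E.
  under eq_fun do rewrite gE.
  apply: cvg_EFin; first exact: nearW.
  rewrite -[X in _ --> X](subrr (0 : R)).
  by apply: cvgB; [move: Fp|move: Fn]; rewrite -(cvg_shiftS _).
by rewrite /Rintegral (cvg_unique _ lim1 lim2).
Unshelve. all: by end_near. Qed.

Lemma cvg_normal_pdf0 (m s : R) : s != 0 ->
  normal_pdf m s n%:R @[n --> \oo] --> 0 /\
  normal_pdf m s (- n%:R) @[n --> \oo] --> 0.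
Proof.
move=> s0.
have s20 : 0 < s ^+ 2 by rewrite exprn_even_gt0.
(* After clearing denominators this is [(u - c - s^2)^2 >= 0]. It bounds the Gaussian tail by a
   multiple of [expR (- u)]; the tail at minus infinity follows by reflection, with [c = - m]. *)
have bnd c (u : R) : - (u - c) ^+ 2 / (s ^+ 2 *+ 2) <= c + s ^+ 2 / 2 - u.
  rewrite ler_pdivrMr ?mulrn_wgt0// -mulr_natr.
  by have := sqr_ge0 (u - c - s ^+ 2); nra.
have cv c : normal_peak s * expR (c + s ^+ 2 / 2) * expR (- n%:R) @[n --> \oo] --> (0 : R).
  rewrite -[X in _ --> X](mulr0 (normal_peak s * expR (c + s ^+ 2 / 2))).
  by apply: cvgM; [exact: cvg_cst|exact: cvgn_expR].
have pdf_le c x u : (x - m) ^+ 2 = (u - c) ^+ 2 ->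
    0 <= normal_pdf m s x <= normal_peak s * expR (c + s ^+ 2 / 2) * expR (- u).
  move=> xu; rewrite normal_pdf_ge0/= normal_pdfE// /normal_fun xu.
  by rewrite -mulrA -expRD ler_wpM2l ?normal_peak_ge0// ler_expR.
split.
- apply: (squeeze_cvgr _ (cvg_cst 0) (cv m)).
  by apply: nearW => n; exact: pdf_le.
- apply: (squeeze_cvgr _ (cvg_cst 0) (cv (- m))).
  apply: nearW => n; apply: pdf_le.
  by rewrite opprK -opprD sqrrN.
Qed.

(** Integration by parts: the derivative of the sine times the density has zero integral over the
    line, because the product vanishes at both ends. *)
Lemma stein_normal (m s th t : R) : s != 0 ->
  \int[normal_prob m s]_x ((x - m) * sin (th + t * (x - m))) =
  s ^+ 2 * t * \int[normal_prob m s]_x (cos (th + t * (x - m))).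
Proof.
move=> s0.
have caff : continuous (fun x : R => th + t * (x - m)).
  move=> x; apply: cvgD; first exact: cvg_cst.
  apply: cvgM; first exact: cvg_cst.
  by apply: cvgB; [exact: cvg_id|exact: cvg_cst].
have csin : continuous (fun x : R => sin (th + t * (x - m))).
  by move=> x; apply: continuous_comp; [exact: caff|exact: continuous_sin].
have ccos : continuous (fun x : R => cos (th + t * (x - m))).
  by move=> x; apply: continuous_comp; [exact: caff|exact: continuous_cos].
have icos : (normal_prob m s).-integrable setT (EFin \o (fun x => cos (th + t * (x - m)))).
  apply: (@bounded_integrable _ _ _ (normal_prob m s) _ 1).
  - exact: continuous_measurable_fun.
  - by move=> x; exact: cos_max.
have isin : (normal_prob m s).-integrable setT (EFin \o (fun x => (x - m) * sin (th + t * (x - m)))).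
  have := integrable_centered_normal m s0.
  apply: le_integrable => //.
    apply/measurable_EFinP/measurable_funM; first exact: measurable_funB.
    exact: continuous_measurable_fun.
  by move=> x _ /=; rewrite lee_fin normrM ler_piMr// sin_max.
have [icos' ->] := Rintegral_normal_prob icos.
have [isin' ->] := Rintegral_normal_prob isin.
pose F x := sin (th + t * (x - m)) * normal_pdf m s x.
pose f x := t * (cos (th + t * (x - m)) * normal_pdf m s x)
  - (s ^+ 2)^-1 * ((x - m) * sin (th + t * (x - m)) * normal_pdf m s x).
have dF (x : R) : is_derive x 1 F (f x).
  have dsin : is_derive x 1 (sin \o (fun x => th + t * (x - m))) (cos (th + t * (x - m)) * t).
    apply: is_derive1_comp.
    have -> : (fun x : R => th + t * (x - m)) = cst th + t \*: (id - cst m) by [].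
    by apply: is_derive_eq; rewrite add0r subr0 /GRing.scale/= mulr1.
  have dp := is_derive_normal_pdf m x s0.
  apply: (is_derive_eq (is_deriveM dsin dp)).
  rewrite /f /GRing.scale/=; field.
  exact: s0.
have cpdf : continuous (normal_pdf m s) by exact: continuous_normal_pdf.
have cf : continuous f.
  move=> x; apply: cvgB; (apply: cvgM; [exact: cvg_cst|apply: cvgM]).
  - exact: ccos.
  - exact: cpdf.
  - by apply: cvgM; [by apply: cvgB; [exact: cvg_id|exact: cvg_cst]|exact: csin].
  - exact: cpdf.
have Fle x : `|F x| <= normal_pdf m s x.
  by rewrite normrM (ger0_norm (normal_pdf_ge0 _ _ _)) ler_piMl ?normal_pdf_ge0// sin_max.
have [p1 p2] := cvg_normal_pdf0 m s0.
have : \int[mu]_x f x = 0.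
  apply: (Rintegral_derive_eq0 dF cf).
  - rewrite /f /comp; under eq_fun do rewrite EFinB !EFinM.
    by apply: integrableB => //; exact: integrableZl.
  - apply: norm_cvg0; apply: (squeeze_cvgr _ (cvg_cst 0) p1).
    by apply: nearW => n; rewrite normr_ge0 Fle.
  - apply: norm_cvg0; apply: (squeeze_cvgr _ (cvg_cst 0) p2).
    by apply: nearW => n; rewrite normr_ge0 Fle.
rewrite RintegralB ?RintegralZl//.
- move=> /eqP; rewrite subr_eq0 => /eqP.
  move=> h; rewrite -mulrA h mulrA mulfV ?mul1r// sqrf_eq0.
  exact: s0.
- by rewrite /comp; under eq_fun do rewrite EFinM; exact: integrableZl.
- by rewrite /comp; under eq_fun do rewrite EFinM; exact: integrableZl.
Qed.
End WholeLine.

(** * The characteristic function of a normal law *)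

Section CharacteristicFunction.
Context {R : realType}.

(** Differentiation under the integral sign: the derivative of the integrand is bounded by [|C|]
    uniformly in the parameter, so any neighbourhood of [t] serves. *)
Lemma is_derive_Rintegral_cos d (T : measurableType d) (P : probability T R)
    (A C : T -> R) (t : R) :
  measurable_fun setT A -> P.-integrable setT (EFin \o C) ->
  is_derive t (1 : R) (fun t => \int[P]_x cos (A x + t * C x))
    (- \int[P]_x (C x * sin (A x + t * C x))).
Proof.
move=> mA iC.
have mC : measurable_fun setT C by apply/measurable_EFinP; exact: measurable_int iC.
have mAC u : measurable_fun setT (fun x => A x + u * C x).
  by apply: measurable_funD => //; exact: measurable_funM.
have msin (g : T -> R) : measurable_fun setT g -> measurable_fun setT (fun x => sin (g x)).
  by move=> mg; apply: measurableT_comp => //; apply: continuous_measurable_fun; exact: continuous_sin.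
have mcos (g : T -> R) : measurable_fun setT g -> measurable_fun setT (fun x => cos (g x)).
  by move=> mg; apply: measurableT_comp => //; apply: continuous_measurable_fun; exact: continuous_cos.
pose f u x := cos (A x + u * C x).
have df u x : is_derive u (1 : R) (f ^~ x) (- (C x * sin (A x + u * C x))).
  have : is_derive u (1 : R) (cos \o (cst (A x) + C x \*: id)) (- sin (A x + C x * u) * C x).
    apply: is_derive1_comp; apply: is_derive_eq.
    by rewrite add0r /GRing.scale/= mulr1.
  have -> : cos \o (cst (A x) + C x \*: id) = f ^~ x.
    by apply/funext => z; rewrite /f /= [z * _]mulrC.
  by rewrite [C x * u]mulrC mulNr [sin _ * _]mulrC.
have pf u x : partial1of2 f u x = - (C x * sin (A x + u * C x)).
  by rewrite partial1of2E; have [_ ->] := df u x.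
have tI : `]t - 1, t + 1[%classic t by rewrite /= in_itv/= ltrBlDr ltrDl ltr01.
have fi u : `]t - 1, t + 1[%classic u -> P.-integrable setT (EFin \o f u).
  move=> _; apply: (@bounded_integrable _ _ _ _ _ 1) => [|x]; last exact: cos_max.
  exact: mcos.
have h1 u x : `]t - 1, t + 1[%classic u -> setT x -> derivable (f ^~ x) u 1.
  by move=> _ _; have [] := df u x.
have iG : P.-integrable setT (EFin \o (fun x => `|C x|)) by exact: integrable_norm iC.
have h2 u x : `]t - 1, t + 1[%classic u -> setT x -> `|partial1of2 f u x| <= `|C x|.
  by move=> _ _; rewrite pf normrN normrM ler_piMr// sin_max.
have dv := derivable_under_integral measurableT tI fi h1 (fun x => normr_ge0 (C x)) iG h2.
have := differentiation_under_integral measurableT tI fi h1 (fun x => normr_ge0 (C x)) iG h2.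
rewrite derive1E => dE; apply: DeriveDef => //; rewrite dE.
under eq_Rintegral do rewrite pf.
have : P.-integrable setT (EFin \o (fun x => C x * sin (A x + t * C x))).
  apply: le_integrable iG => //.
    by apply/measurable_EFinP/measurable_funM => //; exact: msin.
  by move=> x _ /=; rewrite lee_fin normr_id normrM ler_piMr// sin_max.
by move=> ii; under eq_Rintegral do rewrite -mulN1r; rewrite RintegralZl// mulN1r.
Qed.

(** By Stein's identity the integral [psi t] solves [psi' = - s^2 t psi]. Hence [psi t] times
    [expR (s^2 t^2 / 2)] is constant, and its values at 1 and 0 are compared. *)
Lemma Rintegral_normal_prob_cos (m s th : R) : s != 0 ->
  \int[normal_prob m s]_x cos (th + x) = cos (th + m) * expR (- (s ^+ 2 / 2)).
Proof.
move=> s0.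
pose psi t := \int[normal_prob m s]_x cos (th + m + t * (x - m)).
have dpsi t : is_derive t (1 : R) psi (- (s ^+ 2 * t * psi t)).
  rewrite -stein_normal//.
  apply: (@is_derive_Rintegral_cos _ _ (normal_prob m s) (fun=> th + m)) => //.
  exact: integrable_centered_normal.
pose g t := psi t * expR (s ^+ 2 / 2 * t ^+ 2).
have dg (t : R) : is_derive t (1 : R) g 0.
  have de : is_derive t (1 : R) (expR \o ((s ^+ 2 / 2) \*: (id ^+ 2)))
      (expR (s ^+ 2 / 2 * t ^+ 2) * (s ^+ 2 * t)).
    apply: is_derive1_comp; apply: is_derive_eq.
    by rewrite /GRing.scale/=; field.
  apply: (is_derive_eq (is_deriveM (dpsi t) de)).
  by rewrite /GRing.scale/=; ring.
have := is_derive_0_is_cst 1 0 dg.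
rewrite /g expr0n/= mulr0 expR0 mulr1 expr1n mulr1.
have -> : psi 0 = cos (th + m).
  rewrite /psi; under eq_Rintegral do rewrite mul0r addr0.
  rewrite Rintegral_cst//.
  by rewrite [X in fine X](@probability_setT _ _ _ (normal_prob m s)) mulr1.
move=> <-; rewrite -mulrA -expRD subrr expR0 mulr1.
by apply: eq_Rintegral => x _; congr cos; ring.
Qed.

(** Integrals are transferred to the line through the pushforward of [P]. The transfer is stated for
    an arbitrary law [nu] so as to serve both the point mass of the case [v = 0] and the normal law.
    The free phase [th] stands in for a complex exponential: it covers its real and imaginary parts
    at once. *)
Lemma normal_law_cos d (T : measurableType d) (P : probability T R)
    (V : T -> R) (m v : R) : measurable_fun setT V -> 0 <= v ->
  (forall A : set R, measurable A -> P (V @^-1` A) = normal_law m v A) ->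
  P.-integrable setT (EFin \o V) /\
  forall th, \int[P]_x cos (th + V x) = cos (th + m) * expR (- (v / 2)).
Proof.
move=> mV v0 lawV.
have cth th : continuous (fun x : R => cos (th + x)).
  move=> x; apply: continuous_comp; last exact: continuous_cos.
  by apply: cvgD; [exact: cvg_cst|exact: cvg_id].
pose VV : {RV P >-> measurableTypeR R} :=
  MeasurableFun.Pack (MeasurableFun.Class (@isMeasurableFun.Build _ _ _ (measurableTypeR R) V mV)).
have tr (nu : probability (measurableTypeR R) R) th :
    (forall A, measurable A -> P (V @^-1` A) = nu A) ->
    \int[P]_x cos (th + V x) = \int[nu]_x cos (th + x).
  move=> PV; congr fine; transitivity (\int[distribution P VV]_x (cos (th + x))%:E)%E.
    rewrite integral_distribution//.
      by apply/measurable_EFinP; exact: continuous_measurable_fun.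
    change (P.-integrable setT (EFin \o (fun x => cos (th + V x)))).
    apply: (@bounded_integrable _ _ _ _ (fun x => cos (th + V x)) 1) => [|x].
      exact: measurableT_comp (continuous_measurable_fun (cth th)) mV.
    exact: cos_max.
  by apply: eq_measure_integral => A mA _; exact: PV.
have iV (nu : probability (measurableTypeR R) R) :
    (forall A, measurable A -> P (V @^-1` A) = nu A) ->
    nu.-integrable setT (fun x : R => x%:E) -> P.-integrable setT (EFin \o V).
  move=> PV /integrableP[_ fin]; apply/integrableP.
  split; first exact/measurable_EFinP.
  suff -> : (\int[P]_x `|(EFin \o V) x| = \int[nu]_x `|x%:E|)%E by [].
  transitivity (\int[distribution P VV]_x `|x%:E|)%E; last first.
    by apply: eq_measure_integral => A mA _; exact: PV.
  rewrite ge0_integral_distribution//.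
  by apply: measurableT_comp => //; exact/measurable_EFinP.
move: lawV; rewrite /normal_law; have [-> lawV|vn0 lawV] := eqVneq v 0.
  split.
    apply: (iV (\d_(m : measurableTypeR R)) lawV); apply/integrableP.
    split; first exact/measurable_EFinP.
    rewrite integral_dirac//; first by rewrite diracT mul1e ltry.
    by apply: measurableT_comp => //; exact/measurable_EFinP.
  move=> th; rewrite (tr (\d_(m : measurableTypeR R)) _ lawV) mul0r oppr0 expR0 mulr1 /Rintegral.
  rewrite integral_dirac//; first by rewrite diracT mul1e.
  by apply/measurable_EFinP; exact: continuous_measurable_fun.
have s0 : Num.sqrt v != 0 by rewrite gt_eqF// sqrtr_gt0 lt_neqAle eq_sym vn0.
split.
  apply: (iV (normal_prob m (Num.sqrt v)) lawV).
  have := integrableD measurableT (integrable_centered_normal m s0)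
    (finite_measure_integrable_cst (normal_prob m (Num.sqrt v)) m measurableT).
  by apply: eq_integrable => // x _; rewrite /= -EFinD subrK.
move=> th; rewrite (tr (normal_prob m (Num.sqrt v)) _ lawV).
by rewrite Rintegral_normal_prob_cos// sqr_sqrtr.
Qed.
End CharacteristicFunction.

(** * Cosine powers converging to a Gaussian *)

Section CosinePowers.
Context {R : realType}.

Lemma ler_norm_sin (x : R) : `|sin x| <= `|x|.
Proof.
wlog x0 : x / 0 <= x.
  move=> h; have [x0|x0] := leP 0 x; first exact: h.
  by rewrite -(normrN x) -(normrN (sin x)) -sinN h// oppr_ge0 ltW.
have cs : {within `[0, x], continuous (@sin R)}.
  by apply: continuous_subspaceT; exact: continuous_sin.
have [c _] := MVT_segment x0 (fun z _ => is_derive_sin z) cs.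
by rewrite sin0 !subr0 => ->; rewrite normrM ler_piMl// cos_max.
Qed.

(** This is the derivative of [sin] at 0 along the sequence [x / n.+1]; the difference quotient
    needs nonzero increments, so [x = 0] is treated apart. *)
Lemma cvg_sinM (x : R) : n.+1%:R * sin (x / n.+1%:R) @[n --> \oo] --> x.
Proof.
have [->|x0] := eqVneq x 0.
  by under eq_fun do rewrite mul0r sin0 mulr0; exact: cvg_cst.
have [dsin] := is_derive_sin (0 : R).
rewrite cos0 => D1.
have /cvgr_dnbhsP H := dsin.
have := H (fun n => x / n.+1%:R).
rewrite -/(derive (@sin R) 0 1) D1.
have hx : (forall n, x / n.+1%:R != 0) /\ x / n.+1%:R @[n --> \oo] --> 0.
  split=> [n|]; first by rewrite mulf_neq0// invr_eq0.
  rewrite -[X in _ --> X](mulr0 x); apply: cvgM; [exact: cvg_cst|exact: cvg_harmonic].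
move=> /(_ hx) => /(cvgM (cvg_cst x)); rewrite mulr1.
apply: cvg_trans; apply: near_eq_cvg; apply: nearW => n /=.
rewrite addr0 sin0 subr0 /GRing.scale/= mulr1; field.
by rewrite x0 andbT addrC natr1.
Qed.

Lemma ler_norm_subX (a b : R) n : `|a| <= 1 -> `|b| <= 1 ->
  `|a ^+ n - b ^+ n| <= n%:R * `|a - b|.
Proof.
move=> a1 b1; elim: n => [|n ih]; first by rewrite !expr0 subrr normr0 mul0r.
rewrite !exprS.
have -> : a * a ^+ n - b * b ^+ n = a * (a ^+ n - b ^+ n) + (a - b) * b ^+ n by ring.
rewrite (le_trans (ler_normD _ _))// [leRHS](_ : _ = n%:R * `|a - b| + `|a - b|).
  2: by rewrite -natr1; ring.
rewrite !normrM lerD//.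
  by rewrite (le_trans _ ih)// ler_piMl.
by rewrite ler_piMr// normrX exprn_ile1.
Qed.

(* [0 <= expR (- z) - (1 - z) <= z ^ 2], and [M n * z n ^ 2] tends to [0]. *)
Lemma cvg_onem_pow (z : nat -> R) (M : nat -> nat) (l : R) :
  (forall n, 0 <= z n <= 2) -> z n @[n --> \oo] --> 0 ->
  (M n)%:R * z n @[n --> \oo] --> l ->
  (1 - z n) ^+ M n @[n --> \oo] --> expR (- l).
Proof.
move=> zb z0 Mz.
have e1 : expR (- ((M n)%:R * z n)) @[n --> \oo] --> expR (- l).
  by apply: continuous_cvg; [exact: continuous_expR|exact: cvgN].
have e2 : (M n)%:R * z n * z n @[n --> \oo] --> 0.
  by rewrite -[X in _ --> X](mulr0 l); exact: cvgM.
have e3 : (1 - z n) ^+ M n - expR (- ((M n)%:R * z n)) @[n --> \oo] --> 0.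
  apply: norm_cvg0; apply: (squeeze_cvgr _ (cvg_cst 0) e2).
  apply: nearW => n; rewrite normr_ge0/=.
  have /andP[zn0 zn2] := zb n.
  have en1 : expR (- z n) <= 1 by rewrite -expR0 ler_expR oppr_le0.
  rewrite -mulrN expRM_natl.
  have E : `|1 - z n - expR (- z n)| <= z n * z n.
    have h1 := expR_ge1Dx (- z n).
    have h2 : expR (- z n) <= (1 + z n)^-1.
      by rewrite expRN lef_pV2 ?posrE ?expR_gt0 ?expR_ge1Dx// ltr_wpDr.
    have h3 : (1 + z n)^-1 <= 1 - z n + z n * z n.
      by rewrite -[leLHS]mul1r ler_pdivrMr; nra.
    rewrite ler0_norm; lra.
  apply: le_trans (ler_norm_subX _ _ _) _.
  - by rewrite ler_norml; lra.
  - by rewrite ger0_norm// expR_ge0.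
  - by rewrite -mulrA ler_wpM2l.
rewrite -[X in _ --> X]add0r.
apply: cvg_trans (cvgD e3 e1); apply: near_eq_cvg.
by apply: nearW => n /=; rewrite subrK.
Qed.

(** The half-angle formula writes the cosine as [1 - z n] with [n.+1 ^ 2 * z n] tending to
    [x^2 / 2]. The offset [k] is 0 for the weight itself and 1 for its derivative, which loses one
    cosine factor. *)
Lemma cvg_cosX (x : R) (k : nat) :
  cos (x / n.+1%:R) ^+ (n.+1 ^ 2 - k) @[n --> \oo] --> expR (- (x ^+ 2 / 2)).
Proof.
pose z n : R := 2 * sin (x / 2 / n.+1%:R) ^+ 2.
have cosz n : cos (x / n.+1%:R) = 1 - z n.
  have -> : x / n.+1%:R = (x / 2 / n.+1%:R) *+ 2 by rewrite -mulr_natr; field.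
  by rewrite cos_mulr2n /z sin2cos2 -mulr_natr; ring.
under eq_fun do rewrite cosz.
have ns := @cvg_sinM (x / 2).
have nz : (n.+1 ^ 2)%:R * z n @[n --> \oo] --> x ^+ 2 / 2.
  have -> : x ^+ 2 / 2 = 2 * ((x / 2) * (x / 2)) by field.
  apply: cvg_trans (cvgM (cvg_cst (2 : R)) (cvgM ns ns)); apply: near_eq_cvg.
  by apply: nearW => n; rewrite /z natrX /=; ring.
have z0 : z n @[n --> \oo] --> 0.
  have h0 : n.+1%:R^-1 @[n --> \oo] --> (0 : R) := cvg_harmonic.
  rewrite -[X in _ --> X](mul0r (x ^+ 2 / 2)) -[X in X * _](mul0r 0).
  apply: cvg_trans (cvgM (cvgM h0 h0) nz).
  apply: near_eq_cvg; apply: nearW => n; rewrite /= natrX; field.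
  by rewrite addrC natr1.
apply: cvg_onem_pow => //.
- move=> n; rewrite /z mulr_ge0 ?sqr_ge0//=.
  have := sin_max (x / 2 / n.+1%:R); rewrite ler_norml => /andP[h1 h2].
  by rewrite -[leRHS]mulr1 ler_wpM2l// -(expr1n _ 2) -[leLHS]real_normK ?num_real// lerXn2r ?nnegrE ?sin_max.
- rewrite -[X in _ --> X]subr0 -[X in _ - X](mulr0 k%:R).
  apply: cvg_trans (cvgB nz (cvgM (cvg_cst (k%:R : R)) z0)); apply: near_eq_cvg.
  (* Subtraction on [nat] is truncated, so the exponent splits only once [k <= n.+1 ^ 2], which
     holds for large [n]. *)
  near=> n; rewrite natrB ?mulrBl//.
  rewrite (@leq_trans n.+1)//; last by rewrite -mulnn leq_pmulr.
  by rewrite leqW//; near: n; exact: nbhs_infty_ge.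
Unshelve. all: by end_near. Qed.

End CosinePowers.

(** * Stein identity for Gaussian vectors *)

Section GaussianStein.
Context {R : realType} {d : measure_display} {T : measurableType d}.
Context (P : probability T R) {n : nat} (V : T -> 'rV[R]_n).
Context (m : 'rV[R]_n) (S : 'M[R]_n).
Implicit Types (a b : 'cV[R]_n).

Definition lin a (t : T) : R := ((V t - m) *m a) 0 0.
Definition cov a b : R := (a^T *m S *m b) 0 0.

Lemma linD a b t : lin (a + b) t = lin a t + lin b t.
Proof. by rewrite /lin mulmxDr mxE. Qed.

Lemma linZ (c : R) a t : lin (c *: a) t = c * lin a t.
Proof. by rewrite /lin -scalemxAr mxE. Qed.

Lemma covDl a1 a2 b : cov (a1 + a2) b = cov a1 b + cov a2 b.
Proof. by rewrite /cov linearD/= !mulmxDl mxE. Qed.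

Lemma covZl (c : R) a b : cov (c *: a) b = c * cov a b.
Proof. by rewrite /cov linearZ/= -!scalemxAl mxE. Qed.

Lemma covDr a b1 b2 : cov a (b1 + b2) = cov a b1 + cov a b2.
Proof. by rewrite /cov mulmxDr mxE. Qed.

Lemma covZr (c : R) a b : cov a (c *: b) = c * cov a b.
Proof. by rewrite /cov -scalemxAr mxE. Qed.

(* Trigonometric polynomials in the linear forms of [V], each paired with its
   derivative in the direction [S *m b]. *)
Inductive trigp b : (T -> R) -> (T -> R) -> Prop :=
| trigp_sin th a :
    trigp b (fun t => sin (th + lin a t)) (fun t => cov a b * cos (th + lin a t))
| trigp_lin c f f' g g' : trigp b f f' -> trigp b g g' ->
    trigp b (fun t => c * f t + g t) (fun t => c * f' t + g' t).

Lemma trigp_ext b f f' g g' : trigp b f f' -> f =1 g -> f' =1 g' -> trigp b g g'.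
Proof. by move=> h /funext <- /funext <-. Qed.

(** The product-to-sum formula [sin x sin y = (cos (x - y) - cos (x + y)) / 2], with each cosine
    written as a sine shifted by [pi / 2]. *)
Lemma trigp_sin_mul_sin b th1 a1 th2 a2 :
  trigp b (fun t => sin (th1 + lin a1 t) * sin (th2 + lin a2 t))
   (fun t => cov a1 b * cos (th1 + lin a1 t) * sin (th2 + lin a2 t) +
             sin (th1 + lin a1 t) * (cov a2 b * cos (th2 + lin a2 t))).
Proof.
pose s1 := trigp_sin b (th1 - th2 + pi / 2) (a1 + (-1) *: a2).
pose s2 := trigp_sin b (th1 + th2 + pi / 2) (a1 + a2).
have eqm t : th1 - th2 + pi / 2 + lin (a1 + (-1) *: a2) t =
    (th1 + lin a1 t) - (th2 + lin a2 t) + pi / 2 by rewrite linD linZ; ring.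
have eqp t : th1 + th2 + pi / 2 + lin (a1 + a2) t =
    (th1 + lin a1 t) + (th2 + lin a2 t) + pi / 2 by rewrite linD; ring.
(* [trigp_lin] always asks for a last summand; here it is the zero polynomial, obtained as
   [- s2 + s2]. *)
apply: (trigp_ext (trigp_lin 2^-1 s1 (trigp_lin (- 2^-1) s2 (trigp_lin (-1) s2 s2)))).
  move=> t; rewrite eqm eqp; set x := th1 + _; set y := th2 + _.
  by rewrite !sinDpihalf (cosB x) (cosD x); field.
move=> t; rewrite eqm eqp; set x := th1 + _; set y := th2 + _.
by rewrite !cosDpihalf (sinB x) (sinD x) !covDl covZl; field.
Qed.

Lemma trigp_mul b f f' g g' : trigp b f f' -> trigp b g g' ->
  trigp b (fun t => f t * g t) (fun t => f' t * g t + f t * g' t).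
Proof.
move=> hf hg; elim: hf => [th1 a1|c f1 f1' f2 f2' _ h1 _ h2].
  elim: hg => [th2 a2|c g1 g1' g2 g2' _ h1 _ h2]; first exact: trigp_sin_mul_sin.
  by apply: (trigp_ext (trigp_lin c h1 h2)) => t; ring.
by apply: (trigp_ext (trigp_lin c h1 h2)) => t; ring.
Qed.

Lemma trigp_exp b f f' k : trigp b f f' ->
  trigp b (fun t => f t ^+ k) (fun t => k%:R * f t ^+ k.-1 * f' t).
Proof.
move=> hf; elim: k => [|k ih].
  (* The constant 1 is the sine of [pi / 2] plus the zero form. For exponent 0 the truncated [k.-1]
     is harmless, as its factor [k%:R] vanishes. *)
  have h := trigp_sin b (pi / 2) 0.
  have l0 t : lin 0 t = 0 by rewrite /lin mulmx0 mxE.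
  apply: (trigp_ext h) => t; rewrite l0 addr0 ?sin_pihalf ?expr0//.
  by rewrite cos_pihalf mulr0 !mul0r.
apply: (trigp_ext (trigp_mul hf ih)) => t; first by rewrite exprS.
by case: k {ih} => [|k] /=; rewrite ?exprS -?natr1; ring.
Qed.

Context (gV : gaussian_vector P V m S) (symS : S^T = S).

Lemma covC a b : cov a b = cov b a.
Proof. by rewrite /cov -(trmxK (a^T *m S *m b)) mxE !trmx_mul trmxK symS mulmxA. Qed.

Lemma measurable_lin a : measurable_fun setT (lin a).
Proof.
have [mV _] := gV.
have -> : lin a = fun t => \sum_i (V t 0 i - m 0 i) * a i 0.
  by apply/funext => t; rewrite /lin mxE; apply: eq_bigr => i _; rewrite !mxE.
by apply: measurable_sum => i; apply: measurable_funM => //; exact: measurable_funB.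
Qed.

Lemma lin_law a : P.-integrable setT (EFin \o lin a) /\
  forall th, \int[P]_t cos (th + lin a t) = cos th * expR (- (cov a a / 2)).
Proof.
have [mV law] := gV; have [v0 lawa] := law a.
have linE t : lin a t = (V t *m a) 0 0 - (m *m a) 0 0.
  by rewrite /lin mulmxBl mxE [X in _ + X]mxE.
have mVa : measurable_fun setT (fun t => (V t *m a) 0 0).
  have -> : (fun t => (V t *m a) 0 0) = fun t => lin a t + (m *m a) 0 0.
    by apply/funext => t; rewrite linE subrK.
  by apply: measurable_funD => //; exact: measurable_lin.
have [iV cV] := normal_law_cos mVa v0 lawa; split.
  have := integrableB measurableT iV
    (finite_measure_integrable_cst P ((m *m a) 0 0) measurableT).
  by apply: eq_integrable => // t _; rewrite /= linE EFinB.
move=> th; rewrite -[th in RHS](subrK ((m *m a) 0 0)) -cV.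
by apply: eq_Rintegral => t _; congr cos; rewrite linE; ring.
Qed.

(** The map [u |-> E cos (th + L_a + u L_b)] is differentiated at 0 in two ways: under the integral,
    and from its closed form, in which the variance of [L_a + u L_b] has linear coefficient
    [2 cov a b]. *)
Lemma stein_sin a b th :
  \int[P]_t (lin b t * sin (th + lin a t)) =
  \int[P]_t (cov a b * cos (th + lin a t)).
Proof.
have [ib _] := lin_law b; have [_ ca] := lin_law a.
have ml := measurable_lin a.
have mA : measurable_fun setT (fun t => th + lin a t) by exact: measurable_funD.
have D1 := is_derive_Rintegral_cos 0 mA ib.
have icos : P.-integrable setT (EFin \o (fun t => cos (th + lin a t))).
  apply: (@bounded_integrable _ _ _ _ _ 1) => [|t]; last exact: cos_max.
  by apply: measurableT_comp => //; apply: continuous_measurable_fun; exact: continuous_cos.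
rewrite RintegralZl// ca.
pose k := cov a b; pose q := cov a a; pose v := cov b b.
pose F u := cos th * expR (- ((q + 2 * k * u + v * u ^+ 2) / 2)).
have FE : (fun u => \int[P]_t cos (th + lin a t + u * lin b t)) = F.
  apply/funext => u; have [_ cu] := lin_law (a + u *: b).
  transitivity (\int[P]_t cos (th + lin (a + u *: b) t)).
    by apply: eq_Rintegral => t _; rewrite linD linZ addrA.
  rewrite cu /F; congr (_ * expR (- (_ / 2))).
  by rewrite !covDl !covDr !covZl !covZr (covC b a) -/k -/q -/v; ring.
have D2 : is_derive 0 (1 : R) F (- (k * (cos th * expR (- (q / 2))))).
  have : is_derive (0 : R) (1 : R) (cos th \*: (expR \o (cst (- (q / 2)) - k \*: id - (v / 2) \*: (id ^+ 2))))
      (- (k * (cos th * expR (- (q / 2))))).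
    apply: is_derive_eq.
    by rewrite !fctE /= !scaler0 expr0n/= !scaler0 !subr0 /GRing.scale/=; ring.
  congr is_derive; apply/funext => u; rewrite /F !fctE /=; congr (_ * expR _).
  by rewrite /GRing.scale/=; field.
move: D1; rewrite FE => D1.
have := @derive_val _ _ _ _ _ _ _ D1; rewrite (@derive_val _ _ _ _ _ _ _ D2).
move=> /oppr_inj ->; apply: eq_Rintegral => t _; by rewrite mul0r addr0.
Qed.
End GaussianStein.

Lemma integrable_mul_bounded {R : realType} d (T : measurableType d)
    (P : probability T R) (g f : T -> R) (M : R) :
  P.-integrable setT (EFin \o g) -> measurable_fun setT f ->
  (forall x, `|f x| <= M) -> P.-integrable setT (EFin \o (fun x => g x * f x)).
Proof.
move=> ig mf fM.
have mg : measurable_fun setT g by apply/measurable_EFinP; exact: measurable_int ig.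
have := integrableZl measurableT M ig; apply: le_integrable => //.
  by apply/measurable_EFinP/measurable_funM.
move=> x _ /=; rewrite lee_fin !normrM mulrC ler_wpM2r//.
by rewrite (le_trans (fM x))// ler_norm.
Qed.

(** * Stein's identity for limits of trigonometric polynomials *)

Section SteinLimit.
Context {R : realType} {d : measure_display} {T : measurableType d}.
Context (P : probability T R) {n : nat} (V : T -> 'rV[R]_n).
Context (m : 'rV[R]_n) (S : 'M[R]_n).
Context (gV : gaussian_vector P V m S) (symS : S^T = S).
Implicit Types (a b : 'cV[R]_n).
Notation lin := (lin V m).
Notation cov := (cov S).
Notation trigp := (trigp V m S).

Let ilin b : P.-integrable setT (EFin \o lin b) := (lin_law gV b).1.

(** Both sides are linear in the pair, so the case of a sine suffices. Measurability and boundedness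
    are carried through the induction because splitting the integrals needs integrability. *)
Lemma trigp_stein b f f' : trigp b f f' ->
  [/\ measurable_fun setT f, exists M, forall t, `|f t| <= M,
      measurable_fun setT f', exists M, forall t, `|f' t| <= M &
      \int[P]_t (lin b t * f t) = \int[P]_t f' t].
Proof.
elim=> [th a|c {}f {}f' g g' _ [mf [Mf fM] mf' [Mf' fM'] hf] _ [mg [Mg gM] mg' [Mg' gM'] hg]].
  have mA : measurable_fun setT (fun t => th + lin a t).
    by apply: measurable_funD => //; exact: measurable_lin gV a.
  have ms : measurable_fun setT (fun t => sin (th + lin a t)).
    by apply: measurableT_comp => //; apply: continuous_measurable_fun; exact: continuous_sin.
  have mc : measurable_fun setT (fun t => cos (th + lin a t)).
    by apply: measurableT_comp => //; apply: continuous_measurable_fun; exact: continuous_cos.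
  split => //; last exact: stein_sin.
  - by exists 1 => t; exact: sin_max.
  - exact: measurable_funM.
  - by exists `|cov a b| => t; rewrite normrM ler_piMr// cos_max.
have bl M1 M2 h1 h2 : (forall t : T, `|h1 t| <= M1) -> (forall t, `|h2 t| <= M2) ->
    forall t, `|c * h1 t + h2 t| <= `|c| * M1 + M2.
  move=> H1 H2 t; rewrite (le_trans (ler_normD _ _))// lerD// normrM.
  exact: ler_wpM2l.
have i1 : P.-integrable setT (EFin \o (fun t => lin b t * f t)) by exact: integrable_mul_bounded fM.
have i2 : P.-integrable setT (EFin \o (fun t => lin b t * g t)) by exact: integrable_mul_bounded gM.
have i3 : P.-integrable setT (EFin \o f') by exact: bounded_integrable fM'.
have i4 : P.-integrable setT (EFin \o g') by exact: bounded_integrable gM'.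
split.
- by apply: measurable_funD => //; exact: measurable_funM.
- by eexists; exact: bl.
- by apply: measurable_funD => //; exact: measurable_funM.
- by eexists; exact: bl.
transitivity (\int[P]_t (c * (lin b t * f t) + lin b t * g t)).
  by apply: eq_Rintegral => t _; ring.
rewrite !RintegralD ?RintegralZl ?hf ?hg//.
- by rewrite /comp; under eq_fun do rewrite EFinM; exact: integrableZl.
- by rewrite /comp; under eq_fun do rewrite EFinM; exact: integrableZl.
Qed.

(** The bounds are those that dominated convergence needs on both sides of the identity:
    [lin b * F k] is dominated by [|lin b|], and [F' k] by [G]. The bound 1 on [F k], rather than an
    arbitrary constant, makes the notion stable under products with the sum of the two majorants. *)
Definition stein_limit b (f f' : T -> R) :=
  exists (F F' : nat -> T -> R) (G : T -> R),
  [/\ P.-integrable setT (EFin \o G), forall k, trigp b (F k) (F' k),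
      forall k t, `|F k t| <= 1 /\ `|F' k t| <= G t,
      forall t, F k t @[k --> \oo] --> f t &
      forall t, F' k t @[k --> \oo] --> f' t].

Lemma stein_limit_mul b f f' g g' : stein_limit b f f' -> stein_limit b g g' ->
  stein_limit b (fun t => f t * g t) (fun t => f' t * g t + f t * g' t).
Proof.
move=> [F [F' [H [iH tF FH cF cF']]]] [G [G' [K [iK tG GK cG cG']]]].
exists (fun k t => F k t * G k t), (fun k t => F' k t * G k t + F k t * G' k t).
exists (fun t => H t + K t); split=> [|k|k t|t|t].
- by rewrite /comp; under eq_fun do rewrite EFinD; exact: integrableD.
- exact: trigp_mul.
- have [F1 F2] := FH k t; have [G1 G2] := GK k t.
  rewrite normrM mulr_ile1//; split => //.
  rewrite (le_trans (ler_normD _ _))// !normrM lerD//.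
    by rewrite (le_trans _ F2)// ler_piMr.
  by rewrite (le_trans _ G2)// ler_piMl.
- exact: cvgM.
- by apply: cvgD; exact: cvgM.
Qed.

Lemma stein_limit_stein b f f' : stein_limit b f f' ->
  \int[P]_t (lin b t * f t) = \int[P]_t f' t.
Proof.
move=> [F [F' [G [iG tF FG cF cF']]]].
have c1 : (\int[P]_t (lin b t * F k t)%:E @[k --> \oo] --> \int[P]_t (lin b t * f t)%:E)%E.
  apply: (@dominated_cvg _ _ _ P setT measurableT (fun k t => (lin b t * F k t)%:E)
    (fun t => (lin b t * f t)%:E) (fun t => `|lin b t|%:E)) => //.
  - move=> k; apply/measurable_EFinP/measurable_funM; first exact: measurable_lin gV b.
    by have [] := trigp_stein (tF k).
  - move=> t _; apply: cvg_EFin; first exact: nearW.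
    by apply: cvgM; [exact: cvg_cst|exact: cF].
  - exact: integrable_norm (ilin b).
  - by move=> k t _ /=; rewrite lee_fin normrM ler_piMr//; have [] := FG k t.
have c2 : (\int[P]_t (F' k t)%:E @[k --> \oo] --> \int[P]_t (f' t)%:E)%E.
  apply: (@dominated_cvg _ _ _ P setT measurableT (fun k t => (F' k t)%:E)
    (fun t => (f' t)%:E) (fun t => (G t)%:E)) => //.
  - by move=> k; apply/measurable_EFinP; have [] := trigp_stein (tF k).
  - by move=> t _; apply: cvg_EFin; [exact: nearW|exact: cF'].
  - by move=> k t _ /=; rewrite lee_fin; have [] := FG k t.
congr fine; apply: cvg_unique c1 _ => //.
move: c2; apply: cvg_trans; apply: near_eq_cvg; apply: nearW => k.
have [mFk [M FM] mFk' [M' FM'] h] := trigp_stein (tF k).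
rewrite -[LHS]fineK; last first.
  by apply: integrable_fin_num => //; exact: bounded_integrable FM'.
rewrite -[RHS]fineK; last first.
  by apply: integrable_fin_num => //; exact: integrable_mul_bounded FM.
by congr EFin; rewrite -[LHS]/(\int[P]_t F' k t) -h.
Qed.

(** The approximants are [cos (w / k.+1) ^+ (k.+1 ^ 2)]. In their derivatives the factor
    [k.+1 * sin (w / k.+1)] tends to [w] and is bounded by [|w|], which gives an integrable majorant
    since [w] is affine in [lin a]. *)
Lemma stein_limit_gauss b a (u c : R) :
  stein_limit b (fun t => expR (- (((u - lin a t) * c) ^+ 2 / 2)))
    (fun t => expR (- (((u - lin a t) * c) ^+ 2 / 2)) *
              (cov a b * c ^+ 2 * (u - lin a t))).
Proof.
pose w t := (u - lin a t) * c.
have tp k : trigp b (fun t => cos (w t / k.+1%:R))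
    (fun t => cov a b * c / k.+1%:R * sin (w t / k.+1%:R)).
  have eqw t : u * c / k.+1%:R + pi / 2 + lin ((- (c / k.+1%:R)) *: a) t =
    w t / k.+1%:R + pi / 2 by rewrite linZ /w; ring.
  apply: (trigp_ext (trigp_sin V m S b (u * c / k.+1%:R + pi / 2) ((- (c / k.+1%:R)) *: a))) => t.
    by rewrite eqw sinDpihalf.
  by rewrite eqw cosDpihalf covZl; ring.
exists (fun k t => cos (w t / k.+1%:R) ^+ (k.+1 ^ 2)).
exists (fun k t => (k.+1 ^ 2)%:R * cos (w t / k.+1%:R) ^+ (k.+1 ^ 2).-1 *
                   (cov a b * c / k.+1%:R * sin (w t / k.+1%:R))).
exists (fun t => `|cov a b * c * w t|).
have E k t : (k.+1 ^ 2)%:R * cos (w t / k.+1%:R) ^+ (k.+1 ^ 2).-1 *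
      (cov a b * c / k.+1%:R * sin (w t / k.+1%:R)) =
   cos (w t / k.+1%:R) ^+ (k.+1 ^ 2 - 1) * (cov a b * c * (k.+1%:R * sin (w t / k.+1%:R))).
  rewrite subn1 natrX; field.
  by rewrite addrC natr1.
split=> [|k|k t|t|t].
- have iw : P.-integrable setT (EFin \o w).
    have := integrableB measurableT (finite_measure_integrable_cst P (u * c) measurableT)
      (integrableZl measurableT c (ilin a)).
    by apply: eq_integrable => // t _; rewrite /w /=; congr EFin; ring.
  have := integrable_norm (integrableZl measurableT (cov a b * c) iw).
  by apply: eq_integrable.
- exact: trigp_exp.
- split; first by rewrite normrX exprn_ile1// cos_max.
  rewrite E normrM (le_trans (ler_piMl _ _))//.
    by rewrite normrX exprn_ile1// cos_max.
  rewrite [leLHS]normrM [leRHS]normrM ler_wpM2l// normrM.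
  rewrite (le_trans (ler_wpM2l _ (ler_norm_sin _)))// normrM normfV mulrCA divff ?mulr1//.
  by rewrite normr_eq0.
- by have := @cvg_cosX R (w t) 0; under eq_fun do rewrite subn0.
under eq_fun do rewrite E.
have -> : cov a b * c ^+ 2 * (u - lin a t) = cov a b * c * w t by rewrite /w; ring.
apply: cvgM; first exact: cvg_cosX.
by apply: cvgM; [exact: cvg_cst|exact: cvg_sinM].
Qed.

End SteinLimit.

(** * Posterior mean at positive noise *)

(** A zero integral would make [f] vanish almost everywhere; as [f] never vanishes, the exceptional
    null set would be the whole space, of probability 1. *)
Lemma Rintegral_gt0 {R : realType} d (T : measurableType d)
    (P : probability T R) (f : T -> R) :
  P.-integrable setT (EFin \o f) -> (forall t, 0 < f t) -> 0 < \int[P]_t f t.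
Proof.
move=> fi f0; rewrite lt_neqAle Rintegral_ge0 ?andbT; last by move=> t _; exact: ltW.
apply/eqP => I0.
have fin := integrable_fin_num measurableT fi.
have : (\int[P]_t `|(EFin \o f) t| = 0)%E.
  under eq_integral do rewrite /= ger0_norm ?ltW//.
  by rewrite -(fineK fin) -[fine _]/(\int[P]_t f t) -I0.
move/(ae_eq_integral_abs P measurableT (measurable_int P fi)).1.
move=> [N [mN N0 sub]].
have NT : N = setT.
  apply/seteqP; split => // t _; apply: sub => /= /(_ I) [] /eqP.
  by rewrite gt_eqF.
have := probability_setT P; rewrite -NT => PN.
by have := etrans (esym PN) N0; move=> [] /eqP; rewrite oner_eq0.
Qed.

Lemma integrable_Rintegral_sum {R : realType} d (T : measurableType d)
    (P : probability T R) (I : Type) (r : seq I) (f : I -> T -> R) :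
  (forall i, P.-integrable setT (EFin \o f i)) ->
  P.-integrable setT (EFin \o (fun t => \sum_(i <- r) f i t)) /\
  \int[P]_t (\sum_(i <- r) f i t) = \sum_(i <- r) \int[P]_t f i t.
Proof.
move=> fi; elim: r => [|i r [ih1 ih2]].
  split.
    by apply: eq_integrable (integrable0 P setT) => // t _; rewrite /= big_nil.
  rewrite big_nil; under eq_Rintegral do rewrite big_nil.
  by rewrite Rintegral_cst// mul0r.
split; last first.
  rewrite big_cons -ih2 -RintegralD//.
  by apply: eq_Rintegral => t _; rewrite big_cons.
apply: eq_integrable (integrableD measurableT (fi i) ih1) => //.
by move=> t _; rewrite /= big_cons EFinD.
Qed.

Section Product.
Context {R : realType} {d : measure_display} {T : measurableType d}.
Context (P : probability T R) {n : nat} (V : T -> 'rV[R]_n).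
Context (m : 'rV[R]_n) (S : 'M[R]_n) (gV : gaussian_vector P V m S).

Lemma stein_limit_prod (I : Type) (r : seq I) (a : I -> 'cV[R]_n) (u : I -> R)
    (c : R) b :
  stein_limit P V m S b
    (fun t => \prod_(k <- r) expR (- (((u k - lin V m (a k) t) * c) ^+ 2 / 2)))
    (fun t => \prod_(k <- r) expR (- (((u k - lin V m (a k) t) * c) ^+ 2 / 2)) *
      \sum_(k <- r) cov S (a k) b * c ^+ 2 * (u k - lin V m (a k) t)).
Proof.
elim: r => [|k r ih].
  have h := trigp_sin V m S b (pi / 2) 0.
  have l0 t : lin V m 0 t = 0 by rewrite /lin mulmx0 mxE.
  (* The empty product is the constant 1, again represented by the sine of [pi / 2]. *)
  exists (fun _ _ => 1), (fun _ _ => 0), (fun=> 0).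
  split=> [|j|j t|t|t].
  - exact: integrable0.
  - apply: (trigp_ext h) => t; rewrite l0 addr0 ?sin_pihalf//.
    by rewrite cos_pihalf mulr0.
  - by rewrite normr1 normr0.
  - by rewrite big_nil; exact: cvg_cst.
  - by rewrite !big_nil mulr0; exact: cvg_cst.
have := stein_limit_mul (stein_limit_gauss gV b (a k) (u k) c) ih.
by congr stein_limit; apply/funext => t; rewrite !big_cons//; ring.
Qed.
End Product.

(** * The Gaussian matrix model *)

Section Model.
Context {R : realType} {N : nat}.
Implicit Types (A B W : 'M[R]_N) (s y : 'cV[R]_N).

Lemma mulmx_trE (u v : 'cV[R]_N) i j : (u *m v^T) i j = u i 0 * v j 0.
Proof. by rewrite mxE big_ord1 [v^T _ _]mxE. Qed.

Definition entry (i j : 'I_N) : 'cV[R]_(N * N) := delta_mx (mxvec_index i j) 0.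

Lemma lin_entry d (T : measurableType d) (X : T -> 'M[R]_N) B0 i j t :
  lin (fun t => mxvec (X t)) (mxvec B0) (entry i j) t = X t i j - B0 i j.
Proof. by rewrite /lin /entry -linearB/= -colE mxE mxvecE !mxE. Qed.

Lemma cov_entry W i j k l : cov (symkron W) (entry i j) (entry k l) =
  2^-1 * (W i k * W j l + W j k * W i l).
Proof. rewrite -symkronE /cov /entry trmx_delta -rowE -colE.
by rewrite [LHS]mxE [LHS]mxE. Qed.

Lemma tr_symkron W : W^T = W -> (symkron W)^T = symkron W.
Proof.
move=> sW; apply/matrixP => p q; rewrite mxE.
case/mxvec_indexP: p => i j; case/mxvec_indexP: q => k l.
have sWE a b : W a b = W b a by rewrite -{1}sW mxE.
by rewrite !symkronE (sWE k i) (sWE l j) (sWE l i) (sWE k j) [W i l * _]mulrC.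
Qed.

(* [entry i j] and [obs s k] are the linear forms on [mxvec X] with values
   [X i j] and [(X *m s) k 0]. *)
Definition obs s (k : 'I_N) : 'cV[R]_(N * N) := \sum_l s l 0 *: entry k l.

Lemma lin_obs d (T : measurableType d) (X : T -> 'M[R]_N) B0 s k t :
  lin (fun t => mxvec (X t)) (mxvec B0) (obs s k) t =
  (X t *m s) k 0 - (B0 *m s) k 0.
Proof.
rewrite /lin mulmx_sumr summxE !mxE -sumrB; apply: eq_bigr => l _.
have := lin_entry X B0 k l t; rewrite /lin => h.
by rewrite -scalemxAr mxE h; ring.
Qed.

(** The covariance of [(X s)_k] with [X i j]; this is where the vector [W *m s] enters. *)
Lemma cov_obs W s k i j : W^T = W -> cov (symkron W) (obs s k) (entry i j) =
  2^-1 * (W i k * (W *m s) j 0 + W j k * (W *m s) i 0).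
Proof.
move=> sW; have sWE a b : W a b = W b a by rewrite -{1}sW mxE.
transitivity (\sum_l s l 0 * cov (symkron W) (entry k l) (entry i j)).
  rewrite /obs /cov linear_sum/= !mulmx_suml summxE; apply: eq_bigr => l _.
  by rewrite linearZ/= -!scalemxAl mxE.
rewrite !mxE !mulr_sumr -big_split/= mulr_sumr; apply: eq_bigr => l _.
by rewrite cov_entry (sWE k i) (sWE l j) (sWE l i) (sWE k j); ring.
Qed.

(** Up to a constant, the likelihood is the product of Gaussian weights for which Stein's identity
    is established, with scale [sigma^-1]. *)
Lemma likelihoodE s y (sigma : R) A : sigma != 0 -> likelihood s y sigma A =
  normal_peak sigma ^+ N *
  \prod_(k < N) expR (- (((y k 0 - (A *m s) k 0) * sigma^-1) ^+ 2 / 2)).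
Proof.
move=> s0; rewrite /likelihood -[X in _ ^+ X](card_ord N) -prodr_const -big_split/=.
apply: eq_bigr => k _; rewrite normal_pdfE// /normal_fun; congr (_ * expR _).
by field.
Qed.

(* Stein's identity for the likelihood, divided by its mean; [q] is the posterior
   mean of [y - X s], divided by [sigma ^ 2]. *)
Lemma noisy_posterior_mean_fixpoint d (T : measurableType d)
    (P : probability T R) (X : T -> 'M[R]_N) B0 W s y sigma :
  gaussian_model P X B0 W -> W^T = W -> 0 < sigma ->
  let M := noisy_posterior_mean P X s y sigma in
  let q := (sigma ^+ 2)^-1 *: (y - M *m s) in
  M - B0 = 2^-1 *: (W *m q *m (W *m s)^T + W *m s *m (W *m q)^T).
Proof.
move=> [_ gX] sW s0 M q; have sn0 : sigma != 0 by rewrite gt_eqF.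
pose l t := likelihood s y sigma (X t); pose Z := \int[P]_t l t.
pose U k t := y k 0 - (X t *m s) k 0.
pose K t := \prod_(k < N) expR (- ((U k t * sigma^-1) ^+ 2 / 2)).
have lE t : l t = normal_peak sigma ^+ N * K t by rewrite /l likelihoodE.
have iX i j : P.-integrable setT (EFin \o (fun t => X t i j)).
  have := integrableD measurableT (lin_law gX (entry i j)).1
    (finite_measure_integrable_cst P (B0 i j) measurableT).
  by apply: eq_integrable => // t _; rewrite /= lin_entry -EFinD subrK.
have mX i j : measurable_fun setT (fun t => X t i j).
  by apply/measurable_EFinP; exact: measurable_int (iX i j).
have mU k : measurable_fun setT (U k).
  apply: measurable_funB => //.
  have -> : (fun t => (X t *m s) k 0) = fun t => \sum_l X t k l * s l 0.
    by apply/funext => t; rewrite mxE.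
  by apply: measurable_sum => j; exact: measurable_funM.
have mK : measurable_fun setT K.
  apply: measurable_prod => k _; apply: measurableT_comp => //.
  apply: measurableT_comp => //; apply: measurable_funM => //.
  by apply: measurable_funX; exact: measurable_funM.
have K0 t : 0 < K t by apply: prodr_gt0 => k _; exact: expR_gt0.
have K1 t : `|K t| <= 1.
  rewrite (ger0_norm (ltW (K0 t))); apply: Num.Theory.prodr_ile1 => k _.
  rewrite expR_ge0/= -[leRHS]expR0 ler_expR oppr_le0.
  by rewrite divr_ge0 ?sqr_ge0.
have ml : measurable_fun setT l.
  have -> : l = fun t => normal_peak sigma ^+ N * K t by apply/funext.
  exact: measurable_funM.
have l1 t : `|l t| <= normal_peak sigma ^+ N.
  rewrite lE normrM ger0_norm ?exprn_ge0 ?normal_peak_ge0// ler_piMr//.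
  by rewrite exprn_ge0// normal_peak_ge0.
have il : P.-integrable setT (EFin \o l) by exact: bounded_integrable l1.
have iXl i j : P.-integrable setT (EFin \o (fun t => X t i j * l t)).
  exact: integrable_mul_bounded l1.
have Z0 : Z != 0.
  rewrite gt_eqF// Rintegral_gt0// => t.
  by rewrite lE mulr_gt0// exprn_gt0// normal_peak_gt0.
have ME i j : \int[P]_t (X t i j * l t) = M i j * Z by rewrite mxE divfK.
have iZl (c : R) (f : T -> R) : P.-integrable setT (EFin \o f) ->
    P.-integrable setT (EFin \o (fun t => c * f t)).
  by move=> fi; apply: eq_integrable (integrableZl measurableT c fi).
have Xsl k := integrable_Rintegral_sum (index_enum 'I_N)
  (fun j => iZl (s j 0) _ (iXl k j)).
have UlE k t : U k t * l t = y k 0 * l t - \sum_j s j 0 * (X t k j * l t).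
  by rewrite /U mulrBl mxE mulr_suml; congr (_ - _); apply: eq_bigr => j _; ring.
have iUl k : P.-integrable setT (EFin \o (fun t => U k t * l t)).
  apply: eq_integrable (integrableB measurableT (iZl (y k 0) _ il) (Xsl k).1) => //.
  by move=> t _; rewrite /= UlE EFinB.
have UE k : \int[P]_t (U k t * l t) = sigma ^+ 2 * q k 0 * Z.
  under eq_Rintegral do rewrite UlE.
  rewrite (RintegralB measurableT (iZl (y k 0) _ il) (Xsl k).1) RintegralZl//.
  rewrite (Xsl k).2 /q !mxE mulVKf ?expf_neq0// mulrBl; congr (_ - _).
  rewrite mulr_suml; apply: eq_bigr => j _.
  by rewrite RintegralZl// ME; ring.
have LE i j : \int[P]_t ((X t i j - B0 i j) * l t) = (M i j - B0 i j) * Z.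
  under eq_Rintegral do rewrite mulrBl.
  by rewrite (RintegralB measurableT (iXl i j) (iZl (B0 i j) _ il)) RintegralZl// ME mulrBl.
(* These are the coefficients of the residuals [U k] in the derivative of the weight in the
   direction attached to [X i j]. *)
pose c i j k := cov (symkron W) (obs s k) (entry i j) * sigma^-1 ^+ 2.
have cUl i j := integrable_Rintegral_sum (index_enum 'I_N)
  (fun k => iZl (c i j k) _ (iUl k)).
have stein i j : \int[P]_t ((X t i j - B0 i j) * l t) =
    \int[P]_t (\sum_k c i j k * (U k t * l t)).
  (* The normalising constant of the likelihood is absent from the weights; its inverse multiplies
     both sides. *)
  have kn0 : (normal_peak sigma ^+ N)^-1 != 0.
    by rewrite invr_neq0// expf_neq0// gt_eqF// normal_peak_gt0.
  (* The linear forms are centred, so the datum is centred too: [y - B0 s] replaces [y]. *)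
  have uE k t : (y - B0 *m s) k 0 -
      lin (fun t => mxvec (X t)) (mxvec B0) (obs s k) t = U k t.
    by rewrite lin_obs /U !mxE; ring.
  have KE t : \prod_k expR (- ((((y - B0 *m s) k 0 -
      lin (fun t => mxvec (X t)) (mxvec B0) (obs s k) t) / sigma) ^+ 2 / 2)) =
      (normal_peak sigma ^+ N)^-1 * l t.
    rewrite lE mulKf//; last by rewrite -invr_eq0.
    by apply: eq_bigr => k _; rewrite uE.
  have := stein_limit_stein gX (tr_symkron sW) (stein_limit_prod gX (index_enum 'I_N) (obs s)
    (fun k => (y - B0 *m s) k 0) sigma^-1 (entry i j)).
  have iXBl : P.-integrable setT (EFin \o (fun t => (X t i j - B0 i j) * l t)).
    apply: eq_integrable (integrableB measurableT (iXl i j) (iZl (B0 i j) _ il)) => //.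
    by move=> t _; rewrite /= mulrBl EFinB.
  move=> h; apply: (mulfI kn0).
  rewrite -(@RintegralZl _ _ _ _ _ _ _ measurableT iXBl).
  rewrite -(@RintegralZl _ _ _ _ _ _ _ measurableT (cUl i j).1).
  under eq_Rintegral => t _ do rewrite mulrCA -lin_entry -KE.
  rewrite h; apply: eq_Rintegral => t _.
  rewrite KE -mulrA; congr (_ * _); rewrite mulr_sumr; apply: eq_bigr => k _.
  by rewrite uE /c; ring.
(* Multiplying by the normalisation [Z] turns posterior means back into integrals against the prior,
   where Stein's identity applies. *)
apply/matrixP => i j; apply: (mulIf Z0); rewrite mxE [X in (_ + X) * _]mxE -LE stein.
rewrite (cUl i j).2.
transitivity (\sum_k cov (symkron W) (obs s k) (entry i j) * q k 0 * Z).
  by apply: eq_bigr => k _; rewrite RintegralZl// UE /c; field.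
rewrite -mulr_suml; congr (_ * _).
have -> : (2^-1 *: (W *m q *m (W *m s)^T + W *m s *m (W *m q)^T)) i j =
    2^-1 * ((W *m q) i 0 * (W *m s) j 0 + (W *m s) i 0 * (W *m q) j 0).
  by rewrite -!mulmx_trE mxE [X in _ * X = _]mxE.
rewrite [(W *m q) i 0]mxE [(W *m q) j 0]mxE mulr_suml mulr_sumr.
rewrite -big_split/= mulr_sumr; apply: eq_bigr => k _.
by rewrite cov_obs//; ring.
Qed.

End Model.

(** * Linear algebra of the Dennis class *)

Section Algebra.
Context {R : realType} {N : nat}.
Implicit Types (A B W M : 'M[R]_N) (c s y z u v g p q r : 'cV[R]_N).

Lemma dotE u v : dot u v = \sum_k u k 0 * v k 0.
Proof. by rewrite /dot mxE; apply: eq_bigr => k _; rewrite mxE. Qed.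

Lemma dotC u v : dot u v = dot v u.
Proof. by rewrite !dotE; apply: eq_bigr => k _; rewrite mulrC. Qed.

Lemma dotDr u v w : dot u (v + w) = dot u v + dot u w.
Proof. by rewrite /dot mulmxDr mxE. Qed.

Lemma dotZr u (a : R) v : dot u (a *: v) = a * dot u v.
Proof. by rewrite /dot -scalemxAr mxE. Qed.

Lemma dotNr u v : dot u (- v) = - dot u v.
Proof. by rewrite -scaleN1r dotZr mulN1r. Qed.

Lemma dotBr u v w : dot u (v - w) = dot u v - dot u w.
Proof. by rewrite dotDr dotNr. Qed.

Lemma dotBl u v w : dot (u - v) w = dot u w - dot v w.
Proof. by rewrite dotC dotBr !(dotC w). Qed.

Lemma dot_ge0 u : 0 <= dot u u.
Proof. by rewrite dotE sumr_ge0// => k _; rewrite -expr2 sqr_ge0. Qed.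

Lemma dot_gt0 u : u != 0 -> 0 < dot u u.
Proof.
move=> u0; rewrite lt_neqAle dot_ge0 andbT eq_sym dotE psumr_eq0; last first.
  by move=> k _; rewrite -expr2 sqr_ge0.
apply: contra u0 => /allP h; apply/eqP/colP => k; rewrite mxE.
by have := h k (mem_index_enum k); rewrite mulf_eq0 orbb => /eqP.
Qed.

Lemma dot_mulmx W u v : W^T = W -> dot u (W *m v) = dot v (W *m u).
Proof.
move=> sW; rewrite [RHS]dotC /dot mulmxA -[in RHS](trmxK W) sW.
by rewrite trmx_mul trmxK.
Qed.

Lemma mul_outer u v w : u *m v^T *m w = dot v w *: u.
Proof.
by rewrite -mulmxA; apply/colP => k; rewrite mxE big_ord1 [RHS]mxE mulrC.
Qed.

(** Products of two values of the quadratic form do not change under [W -> - W], which lets both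
    signs be treated together. *)
Lemma definiteP W : definite W -> W^T = W /\
  forall u v, 0 <= dot u (W *m u) * dot v (W *m v) /\
              (v != 0 -> dot v (W *m v) != 0).
Proof.
have pos A : posdef A -> forall v, 0 <= dot v (A *m v).
  move=> [_ Av] v; have [->|/Av/ltW//] := eqVneq v 0.
  by rewrite mulmx0 /dot mulmx0 mxE.
move=> [] pW; have [sW gt] := pW; have ge := pos _ pW.
  split=> // u v; split; first exact: mulr_ge0.
  by move=> /gt; rewrite lt_neqAle eq_sym => /andP[].
have dN v : dot v (- W *m v) = - dot v (W *m v) by rewrite mulNmx dotNr.
split; first by apply: oppr_inj; rewrite -[RHS]sW linearN.
move=> u v; split; first by rewrite -mulrNN mulr_ge0// -dN.
by move=> /gt; rewrite dN oppr_gt0 lt_neqAle => /andP[].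
Qed.

(** The quadratic form vanishes at any kernel vector, so the kernel is trivial. *)
Lemma definite_unitmx W : definite W -> W \in unitmx.
Proof.
move=> /definiteP[sW dW]; rewrite -row_free_unit -kermx_eq0.
apply/eqP/row_matrixP => i; rewrite row0; apply: trmx_inj; rewrite trmx0.
apply/eqP; apply: contraT => v0; have [_ /(_ v0)] := dW 0 (row i (kermx W))^T.
rewrite -[X in X *m _]sW -trmx_mul -row_mul mulmx_ker row0 trmx0.
by rewrite /dot mulmx0 mxE eqxx.
Qed.

Let addE m1 n1 (E F : 'M[R]_(m1, n1)) i j : (E + F) i j = E i j + F i j.
Proof. by rewrite mxE. Qed.

Let oppE m1 n1 (E : 'M[R]_(m1, n1)) i j : (- E) i j = - E i j.
Proof. by rewrite mxE. Qed.

Let scaleE m1 n1 (a : R) (E : 'M[R]_(m1, n1)) i j : (a *: E) i j = a * E i j.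
Proof. by rewrite mxE. Qed.

Let mx_linE := (addE, oppE, scaleE).

Lemma dennis_updateE B s y c i j : dennis_update B s y c i j = B i j +
  (dot c s)^-1 * ((y - B *m s) i 0 * c j 0 + c i 0 * (y - B *m s) j 0) -
  (dot c s ^+ 2)^-1 * (dot s (y - B *m s) * c i 0 * c j 0).
Proof.
rewrite /dennis_update; set d := y - _.
by rewrite mul_outer -!scalemxAl !(mx_linE, mulmx_trE); ring.
Qed.

Lemma dennis_updateZ B s y c (a : R) : a != 0 ->
  dennis_update B s y (a *: c) = dennis_update B s y c.
Proof.
move=> a0; apply/matrixP => i j; rewrite !dennis_updateE.
rewrite [dot (a *: c) s]dotC dotZr [dot s c]dotC ![(a *: c) _ _]mxE.
(* When [dot c s] is 0, both sides reduce to [B] because the inverse of 0 is 0. *)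
have [->|cs0] := eqVneq (dot c s) 0; first by rewrite mulr0 expr0n/= invr0 !mul0r.
by field; rewrite a0 cs0.
Qed.

(** With [d = (M - B) s], the hypothesis gives [2 d = (c.s) g + (g.s) c] and hence
    [s.d = (c.s) (g.s)]. Eliminating [g] from these leaves the Dennis formula. *)
Lemma dennis_update_self B M s c g : dot c s != 0 ->
  M - B = 2^-1 *: (g *m c^T + c *m g^T) -> M = dennis_update B s (M *m s) c.
Proof.
move=> cs0 MB.
have dE : M *m s - B *m s = 2^-1 *: (dot c s *: g + dot g s *: c).
  by rewrite -mulmxBl MB -scalemxAl mulmxDl !mul_outer.
apply/matrixP => i j; rewrite dennis_updateE dE.
have /matrixP/(_ i j) := MB.
rewrite !(mx_linE, mulmx_trE) => /eqP; rewrite subr_eq => /eqP ->.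
rewrite dotZr dotDr !dotZr [dot s g]dotC [dot s c]dotC.
by field.
Qed.

Lemma affine_familyP s z : s != 0 -> affine_family s z.
Proof.
(* The base point is the update of the zero matrix with vector [s]: it is symmetric and sends [s] to
   [z]. *)
move=> s0; pose W0 := dennis_update 0 s z s.
have ss0 : dot s s != 0 by rewrite gt_eqF// dot_gt0.
have sW0 : W0^T = W0.
  by apply/matrixP => i j; rewrite mxE !dennis_updateE !mxE; ring.
have W0s : W0 *m s = z.
  rewrite /W0 /dennis_update mul0mx subr0 add0r mulmxBl -!scalemxAl mulmxDl.
  rewrite !mul_outer scalerDr !scalerA mulVf// scale1r.
  rewrite [dot z s]dotC -addrA -scalerBl.
  have -> : (dot s s)^-1 * dot s z - dot s s ^- 2 * (dot s s * dot s z) = 0.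
    by field.
  by rewrite scale0r addr0.
(* The direction space consists of the symmetric matrices that annihilate [s], as an intersection of
   two kernels. *)
pose f : 'Hom('M[R]_N, 'M[R]_N) := linfun (@trmx R N N \- idfun).
pose g : 'Hom('M[R]_N, 'cV[R]_N) := linfun (mulmxr s).
have fE A : (A \in lker f) = (A^T == A).
  by rewrite memv_ker lfunE /= subr_eq0.
have gE A : (A \in lker g) = (A *m s == 0) by rewrite memv_ker lfunE.
exists W0, (lker f :&: lker g)%VS; split.
  move=> N1 V0; have [i si0] : exists i, s i 0 != 0.
    apply/existsP; apply: contraNT s0; rewrite negb_exists => /forallP h.
    by apply/eqP/colP => i; rewrite mxE; apply/eqP; have := h i; rewrite negbK.
  have [j ij] : exists j : 'I_N, j != i.
    have /card_gt1P[x [x' [_ _ xx']]] : (1 < #|'I_N|)%N by rewrite card_ord.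
    by have [xi|xi] := eqVneq x i; [exists x'; rewrite -xi eq_sym|exists x].
  (* This [u] is orthogonal to [s], so [u u^T] lies in the direction space; its entry at [(j, j)] is
     the square of [s i 0], which is nonzero. *)
  pose u : 'cV[R]_N := s j 0 *: delta_mx i 0 - s i 0 *: delta_mx j 0.
  have us : dot u s = 0.
    have dd k : dot (delta_mx k 0) s = s k 0.
      by rewrite /dot trmx_delta -rowE mxE.
    by rewrite dotC dotBr !dotZr ![dot s _]dotC !dd mulrC subrr.
  have : u *m u^T \in (lker f :&: lker g)%VS.
    by rewrite memv_cap fE gE trmx_mul trmxK eqxx mul_outer us scale0r eqxx.
  rewrite V0 memv0 => /eqP/matrixP/(_ j j).
  rewrite mulmx_trE !mxE !eqxx (negbTE ij) /= mulr0 mulr1 sub0r mulrNN.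
  by move/eqP; rewrite mulf_eq0 orbb (negbTE si0).
move=> W; rewrite memv_cap fE gE mulmxBl W0s subr_eq0 linearB/= sW0.
split=> [[-> ->]|/andP[/eqP sW /eqP ->]]; first by rewrite !eqxx.
by split => //; apply: (addIr (- W0)).
Qed.

Lemma only_consistentP s (h : 'cV[R]_N -> 'cV[R]_N) A :
  A^T = A -> (forall v, h v = A *m v) -> only_consistent s h A.
Proof.
move=> sA hE W; split=> [[_ _ Wh]|->]; last by split.
apply/matrixP => i j; have := Wh (delta_mx j 0).
by rewrite hE -!colE => /colP/(_ i); rewrite !mxE.
Qed.

End Algebra.

(** * The noise-free limit *)

(* With [p] the solution of the system for [v = 0], the pairing of the difference
   of the two systems with [q - p] gives [dot q (q - p) <= 0]. *)
Lemma residual_bound {R : realType} {N : nat} (W : 'M[R]_N) (s e : 'cV[R]_N) :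
  definite W -> s != 0 ->
  exists C : R, forall (v : R) (q : 'cV[R]_N), 0 < v ->
    2^-1 *: (dot (W *m s) s *: (W *m q) + dot (W *m q) s *: (W *m s)) =
      e - v *: q ->
    forall k, `|q k 0| <= C.
Proof.
move=> dW s0; have [sW posW] := definiteP dW; have uW := definite_unitmx dW.
set c := W *m s; have cs0 : dot c s != 0.
  by rewrite dotC; have [_ ->] := posW 0 s.
have csW q : dot (W *m q) s = dot c q by rewrite dotC dot_mulmx// dotC.
(* Solving [((c.s) g + (g.s) c) / 2 = e]: pairing with [s] gives [g.s = (s.e) / (c.s)], and then [g]
   is read off. *)
pose g := (dot c s)^-1 *: (2 *: e - (dot s e / dot c s) *: c).
pose p := invmx W *m g.
have Wp : W *m p = g by rewrite mulKVmx.
have gs : dot g s = dot s e / dot c s.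
  by rewrite dotC dotZr dotBr !dotZr [dot s c]dotC; field.
have pE : 2^-1 *: (dot c s *: (W *m p) + dot (W *m p) s *: c) = e.
  rewrite Wp gs /g scalerA mulfV// scale1r subrK scalerA mulVf ?scale1r//.
(* Since [|t| <= 1 + t^2], this constant bounds the entries of [q] once [dot q q <= dot p p],
   without a square root. *)
exists (1 + dot p p) => v q v0 qE k.
pose r := q - p.
have rE : 2^-1 *: (dot c s *: (W *m r) + dot c r *: c) = - (v *: q).
  rewrite -(csW r); transitivity (e - v *: q - e); last by rewrite addrC addKr.
  rewrite -qE -[X in _ - X]pE -scalerBr; congr (_ *: _).
  by rewrite /r mulmxBr dotBl scalerBr scalerBl opprD addrACA.
have qr : dot q r <= 0.
  have /(congr1 (dot r)) := rE.
  rewrite dotZr dotDr !dotZr dotNr dotZr [dot r q]dotC => h.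
  (* Twice the pairing of the left side with [r] is [(s.Ws) (r.Wr) + (c.r)^2], nonnegative for
     either sign of [W]. *)
  have h0 : 0 <= dot c s * dot r (W *m r) + dot c r * dot r c.
    rewrite addr_ge0//; last by rewrite [dot r c]dotC -expr2 sqr_ge0.
    by rewrite [dot c s]dotC; have [] := posW s r.
  by rewrite -(pmulr_rle0 _ v0) -oppr_ge0 -h mulr_ge0.
have qq : dot q q <= dot p p.
  have h0 := dot_ge0 (q - p).
  move: qr h0; rewrite /r !(dotBr, dotBl) [dot p q]dotC; lra.
have qk : q k 0 ^+ 2 <= dot q q.
  rewrite dotE (bigD1 k)//= expr2 lerDl sumr_ge0// => j _.
  by rewrite -expr2 sqr_ge0.
have := real_normK (num_real (q k 0)); have := normr_ge0 (q k 0).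
by move: qk qq; nra.
Qed.

Lemma posterior_mean_definite {R : realType} {N : nat} (B0 W : 'M[R]_N)
    (s y : 'cV[R]_N) : definite W -> s != 0 ->
  posterior_mean_is B0 W s y (dennis_update B0 s y (W *m s)).
Proof.
move=> dW s0 d T P X gX i j; have [sW posW] := definiteP dW.
have cs0 : dot (W *m s) s != 0 by rewrite dotC; have [_ ->] := posW 0 s.
pose M sigma := noisy_posterior_mean P X s y sigma.
pose q sigma := (sigma ^+ 2)^-1 *: (y - M sigma *m s).
have ME sigma : 0 < sigma -> M sigma - B0 =
    2^-1 *: (W *m q sigma *m (W *m s)^T + W *m s *m (W *m q sigma)^T).
  exact: noisy_posterior_mean_fixpoint.
have qE sigma : 0 < sigma -> y - M sigma *m s = sigma ^+ 2 *: q sigma.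
  by move=> sigma0; rewrite scalerA mulfV ?scale1r// expf_neq0// gt_eqF.
have [C HC] := residual_bound (y - B0 *m s) dW s0.
have qC sigma k : 0 < sigma -> `|q sigma k 0| <= C.
  move=> sigma0; apply: (HC (sigma ^+ 2)); first by rewrite exprn_gt0.
  (* Applied to [s], the matrix equation for [M sigma] becomes the system of [residual_bound] with
     [v = sigma^2]. *)
  have -> : y - B0 *m s - sigma ^+ 2 *: q sigma = (M sigma - B0) *m s.
    by rewrite -qE// mulmxBl addrAC opprB addrCA subrr addr0.
  by rewrite ME// -scalemxAl mulmxDl !mul_outer.
have Mc k : (M sigma *m s) k 0 @[sigma --> 0^'+] --> y k 0.
  apply/subr_cvg0; apply: norm_cvg0.
  have sq : sigma ^+ 2 * C @[sigma --> (0 : R)^'+] --> 0.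
    rewrite -[X in _ --> X](mul0r C); apply: cvgM; last exact: cvg_cst.
    apply: cvg_at_right_filter; rewrite -[X in _ --> X](expr0n R 2).
    exact: exprn_continuous.
  apply: (squeeze_cvgr _ (cvg_cst 0) sq); near=> sigma.
  have sigma0 : 0 < sigma by near: sigma; exact: nbhs_right_gt.
  have /colP/(_ k) := qE _ sigma0; rewrite mxE [X in _ + X]mxE [RHS]mxE => h.
  rewrite normr_ge0 /= distrC h normrM ger0_norm ?sqr_ge0// ler_wpM2l ?sqr_ge0//.
  exact: qC.
(* For each positive [sigma] the posterior mean is this update at the data [M sigma *m s]; what
   remains is continuity in the data, the denominators being fixed. *)
pose D x := dennis_update B0 s x (W *m s) i j.
have -> : dennis_update B0 s y (W *m s) i j = D y by [].
have MD : \forall sigma \near (0 : R)^'+, D (M sigma *m s) = M sigma i j.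
  near=> sigma; have sigma0 : 0 < sigma by near: sigma; exact: nbhs_right_gt.
  by rewrite /D -(dennis_update_self cs0 (ME _ sigma0)).
suff cD : D (M sigma *m s) @[sigma --> 0^'+] --> D y.
  by apply: cvg_trans cD; exact: near_eq_cvg.
rewrite /D dennis_updateE; under eq_fun do rewrite dennis_updateE.
have dc k : (M sigma *m s - B0 *m s) k 0 @[sigma --> 0^'+] --> (y - B0 *m s) k 0.
  rewrite mxE [X in _ + X]mxE; under eq_fun do rewrite mxE [X in _ + X]mxE.
  by apply: cvgB => //; exact: cvg_cst.
have sc : dot s (M sigma *m s - B0 *m s) @[sigma --> 0^'+] --> dot s (y - B0 *m s).
  rewrite dotE; under eq_fun do rewrite dotE.
  by apply: cvg_big => [|k _]; [exact: add_continuous|apply: cvgM => //; exact: cvg_cst].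
apply: cvgB; first apply: cvgD; first exact: cvg_cst.
- apply: cvgM; first exact: cvg_cst.
  by apply: cvgD; apply: cvgM => //; exact: cvg_cst.
- apply: cvgM; first exact: cvg_cst.
  by apply: cvgM; [apply: cvgM => //|]; exact: cvg_cst.
Unshelve. all: by end_near. Qed.

(** The factor [alpha] only rescales the vector [W s], and the update is invariant under such
    scaling. Each named update then amounts to computing [W s]. *)
Lemma posterior_mean_multiple {R : realType} {N : nat} (B0 W : 'M[R]_N)
    (s y c : 'cV[R]_N) (alpha : R) :
  alpha != 0 -> s != 0 -> W *m s = c -> definite (alpha *: W) ->
  posterior_mean_is B0 (alpha *: W) s y (dennis_update B0 s y c).
Proof.
move=> a0 s0 <- dW; rewrite -(dennis_updateZ _ _ _ _ a0) scalemxAl.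
exact: posterior_mean_definite.
Qed.

Theorem corollary3p1 (R : realType) (N : nat) (B B0 : 'M[R]_N)
    (s y : 'cV[R]_N) (alpha : R)
    (hB : posdef B) (hB0 : B0^T = B0) (hs : s != 0) (hy : y = B *m s)
    (halpha : alpha != 0) :
  [/\ (* PSB *)
      definite (alpha *: (1%:M : 'M[R]_N)) ->
        posterior_mean_is B0 (alpha *: 1%:M) s y (dennis_update B0 s y s),
      (* SR1 *)
      [/\ definite (alpha *: (B - B0)) ->
            posterior_mean_is B0 (alpha *: (B - B0)) s y
              (dennis_update B0 s y (y - B0 *m s)),
          affine_family s (alpha *: (y - B0 *m s)) &
          only_consistent s (fun v => alpha *: (B *m v - B0 *m v))
            (alpha *: (B - B0))],
      (* Greenstadt *)
      definite (alpha *: B0) ->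
        posterior_mean_is B0 (alpha *: B0) s y
          (dennis_update B0 s y (B0 *m s)),
      (* DFP *)
      [/\ definite (alpha *: B) ->
            posterior_mean_is B0 (alpha *: B) s y (dennis_update B0 s y y),
          affine_family s (alpha *: y) &
          only_consistent s (fun v => alpha *: (B *m v)) (alpha *: B)] &
      (* BFGS *)
      0 < dot s (B0 *m s) ->
      let r := Num.sqrt (dot s (B *m s) / dot s (B0 *m s)) in
      [/\ definite (alpha *: (B + r *: B0)) ->
            posterior_mean_is B0 (alpha *: (B + r *: B0)) s y
              (dennis_update B0 s y
                (y + Num.sqrt (dot y s / dot s (B0 *m s)) *: (B0 *m s))),
          affine_family s (alpha *: (y + r *: (B0 *m s))) &
          only_consistent s (fun v => alpha *: (B *m v + r *: (B0 *m v)))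
            (alpha *: (B + r *: B0))]].
Proof.
have [sB _] := hB.
split.
- by apply: posterior_mean_multiple => //; rewrite mul1mx.
- split; last 2 first.
  + exact: affine_familyP.
  + apply: only_consistentP => [|v]; first by rewrite linearZ linearB/= sB hB0.
    by rewrite -scalemxAl mulmxBl.
  + by apply: posterior_mean_multiple => //; rewrite mulmxBl hy.
- exact: posterior_mean_multiple.
- split; last 2 first.
  + exact: affine_familyP.
  + by apply: only_consistentP => [|v]; rewrite ?linearZ/= ?sB// -scalemxAl.
  + by apply: posterior_mean_multiple.
- move=> _ r; split; last 2 first.
  + exact: affine_familyP.
  + apply: only_consistentP => [|v].
      by rewrite linearZ linearD linearZ/= sB hB0.
    by rewrite -scalemxAl mulmxDl -scalemxAl.
  + apply: posterior_mean_multiple => //.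
    (* As [y = B s], the quotients under the two square roots coincide. *)
    by rewrite mulmxDl -scalemxAl -hy /r -hy [dot y s]dotC.
Qed.
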